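(* Let $R$ be a nonzero commutative Noetherian ring. Then $$\mathcal{C}_R=\operatorname{Cot}(R)\quad\Longleftrightarrow\quad \operatorname{gldim}R\leq1\ \text{ and }\ |\operatorname{Spec}R|\leq\aleph_0 .$$ In this case (that is, when these equivalent conditions hold), for every cotorsion $R$-module $C$ there is an injective $R$-module $D$ such that $D\oplus C\in\mathcal{L}_R$.
   Context: Rings are unital and associative; modules are unital left modules. For a ring $R$: $\mathcal{L}_R$ is the class of all $R$-modules isomorphic to an inverse limit $\varprojlim_{n<\omega}(I_n,p_n)$ of a tower indexed by $\omega$ in which every $I_n$ is an injective $R$-module and every connecting map $p_n:I_{n+1}\to I_n$ is a surjective $R$-linear map. $\mathcal{C}_R$ is the class of all $R$-modules isomorphic to a direct summand of some $L\in\mathcal{L}_R$. An $R$-module $C$ is cotorsion (in the sense of Enochs) if $\operatorname{Ext}^1_R(F,C)=0$ for every flat left $R$-module $F$; $\operatorname{Cot}(R)$ is the class of cotorsion $R$-modules. $\operatorname{gldim}R$ is the global dimension of $R$ and $\operatorname{Spec}R$ is the set of prime ideals of $R$. *)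

(* Defs.v *)
From HB Require Import structures.
From mathcomp Require Import all_boot all_order all_algebra sesquilinear.
From mathcomp Require Import boolp classical_sets cardinality.

Set Implicit Arguments.
Unset Strict Implicit.
Unset Printing Implicit Defensive.

Import GRing.Theory.
Local Open Scope ring_scope.

Definition surjective (A B : Type) (f : A -> B) : Prop :=
  forall y, exists x, f x = y.

Section Ideals.
Variable R : comNzRingType.

Definition is_ideal (I : set R) : Prop := submod_closed ([in I] : {pred R^o}).

Definition finitely_generated_ideal (I : set R) : Prop :=
  exists (n : nat) (g : 'I_n -> R),
    forall x, I x <-> exists c : 'I_n -> R, x = \sum_(i < n) c i * g i.

Definition noetherian : Prop :=
  forall I : set R, is_ideal I -> finitely_generated_ideal I.

(* [idealr_closed] contains the requirement that 1 is not in P. *)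
Definition is_prime_ideal (P : set R) : Prop :=
  idealr_closed [in P] /\ prime_idealr_closed [in P].

Definition Spec : set (set R) := [set P | is_prime_ideal P].

End Ideals.

Arguments Spec : clear implicits.

Section Modules.
Variable R : comNzRingType.

Definition isomorphic (M N : lmodType R) : Prop :=
  exists f : {linear M -> N}, bijective f.

Definition injective_module (E : lmodType R) : Prop :=
  forall (A B : lmodType R) (i : {linear A -> B}) (f : {linear A -> E}),
    injective i -> exists g : {linear B -> E}, g \o i =1 f.

Definition projective_module (P : lmodType R) : Prop :=
  forall (A B : lmodType R) (q : {linear A -> B}) (f : {linear P -> B}),
    surjective q -> exists g : {linear P -> A}, q \o g =1 f.

(* (T, beta) is the tensor product of A and B over R. *)
Definition is_tensor_product (A B T : lmodType R)
    (beta : {bilinear A -> B -> T}) : Prop :=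
  forall (V : lmodType R) (phi : {bilinear A -> B -> V}),
    exists h : {linear T -> V},
      (forall a b, h (beta a b) = phi a b) /\
      (forall h' : {linear T -> V},
         (forall a b, h' (beta a b) = phi a b) -> h' =1 h).

(* The map h is id_F (x) i : F (x) A -> F (x) B. *)
Definition flat_module (F : lmodType R) : Prop :=
  forall (A B : lmodType R) (i : {linear A -> B}), injective i ->
  forall (FA FB : lmodType R)
    (bA : {bilinear F -> A -> FA}) (bB : {bilinear F -> B -> FB}),
    is_tensor_product bA -> is_tensor_product bB ->
  forall h : {linear FA -> FB},
    (forall x a, h (bA x a) = bB x (i a)) -> injective h.

Record projective_resolution (M : lmodType R) := ProjectiveResolution {
  pr_mod : nat -> lmodType R;
  pr_diff : forall n, {linear pr_mod n.+1 -> pr_mod n};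
  pr_aug : {linear pr_mod 0%N -> M};
  pr_projective : forall n, projective_module (pr_mod n);
  pr_aug_surj : surjective pr_aug;
  pr_exact0 : forall x, pr_aug x = 0 <-> exists y, pr_diff 0%N y = x;
  pr_exactS : forall n x,
    pr_diff n x = 0 <-> exists y, pr_diff n.+1 y = x
}.

(* Ext^1_R(M, N) = 0: for a projective resolution P of M, every 1-cocycle of
   Hom_R(P, N) is a coboundary.  Ext does not depend on the choice of P. *)
Definition ext1_vanishes (M N : lmodType R) : Prop :=
  forall (P : projective_resolution M) (f : {linear pr_mod P 1 -> N}),
    (forall x, f (pr_diff P 1 x) = 0) ->
    exists g : {linear pr_mod P 0 -> N}, forall x, f x = g (pr_diff P 0 x).

Definition cotorsion (C : lmodType R) : Prop :=
  forall F : lmodType R, flat_module F -> ext1_vanishes F C.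

Definition projdim_le (M : lmodType R) (n : nat) : Prop :=
  exists P : projective_resolution M,
    forall k, (n < k)%N -> forall x : pr_mod P k, x = 0.

(* L, with projections pi n, is the inverse limit of the tower (I, p): it is
   identified with the module of threads of the product of the I n. *)
Definition is_inverse_limit (I : nat -> lmodType R)
    (p : forall n, {linear I n.+1 -> I n})
    (L : lmodType R) (pi : forall n, {linear L -> I n}) : Prop :=
  (forall n y, p n (pi n.+1 y) = pi n y) /\
  (forall x : forall n, I n, (forall n, p n (x n.+1) = x n) ->
     exists! y : L, forall n, pi n y = x n).

Definition in_L (M : lmodType R) : Prop :=
  exists (I : nat -> lmodType R) (p : forall n, {linear I n.+1 -> I n})
         (pi : forall n, {linear M -> I n}),
    [/\ forall n, injective_module (I n),
        forall n, surjective (p n)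
      & is_inverse_limit p pi].

Definition in_C (M : lmodType R) : Prop :=
  exists L N : lmodType R, in_L L /\ isomorphic (M * N)%type L.

End Modules.

Definition gldim_le (R : comNzRingType) (n : nat) : Prop :=
  forall M : lmodType R, projdim_le M n.

(* Main.v *)
From HB Require Import structures.
Require Import Defs.
From mathcomp Require Import all_boot all_order all_algebra sesquilinear.
From mathcomp Require Import boolp classical_sets functions cardinality.
From mathcomp Require Import zify ring.

(** The proof turns both sides into statements about the ideals of [R].

    Global dimension at most one means that quotients of injective modules are
    injective, and for noetherian [R] that every ideal is projective, i.e. has a
    dual basis ([gldim1_quotients_injective], [quotients_injective_hereditary],
    [hereditary_quotients_injective], [quotients_injective_gldim1]).  Dual bases
    give all the ideal theory needed: an ideal contains a regular element after
    adding an idempotent that kills it ([regular_complement]), flat means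
    torsion-free ([torsion_free_flat], [flat_torsion_free]), and modules on which
    regular elements are invertible are injective ([invertible_injective]).

    Let [R] be hereditary and [C] cotorsion.  Choose a surjection of a free
    module [F] onto [C], and extend the map taking an eventually constant
    sequence in [F] to the class of its eventual value to all of [F^N].  The
    kernel [V] is dense in [F^N].  If [D] is injective and contains [V], the
    quotients of [D] by the submodules of [V] of sequences with [n] leading zeros
    are injective, and their limit is an extension of [C = F^N / V] by [D], so it
    is the direct sum of [D] and [C] ([dense_quotient_limit], [cotorsion_in_L]).

    Conversely let [L] be the limit of a tower [I_n], and let the spectrum be
    countable.  The total ring of fractions [K] is then [R[1/s_0, 1/s_1, ...]]
    for a sequence [s] ([exhausting_sequence]).  A convergent series shows
    [Ext^1(K, L) = 0] ([localization_ext_limit]).  So the sequence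
    [0 -> Hom(K, L) -> prod_n Hom(K, I_n) -> prod_n Hom(K, I_n) -> 0] is exact,
    and it splits as its kernel is injective ([delta_split]); hence the first
    derived limit of the [Hom(F, I_n)] vanishes for divisible torsion-free [F],
    and then [Ext^1(F, L) = 0] for every flat [F] ([in_L_cotorsion]).

    Now suppose that the two classes agree.  The dual [Hom(N, E)] of a module
    into an injective one is cotorsion ([dual_cotorsion]), so it has injective
    dimension at most one, like all summands of limits.  Applied to the bidual
    of the module of relations between generators of an ideal, in which that
    module is pure, this splits the relations ([cotorsion_in_C_hereditary]).
    If the spectrum were uncountable, uncountably many primes [P] would lie
    strictly above one prime [Q].  The module [M] of sequences in [R] modulo
    finite ones is a summand of a limit, so it would be cotorsion.  As
    [Ext^1] of the sum of the [P^(-2)] by [M] then vanishes, the elements of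
    [M / P^2 M] given by constants [x_P] in [P] but not in [P^2] would all come
    from one element of [M]; but an element of [R] lies in uncountably many of
    the [P] only if it lies in [Q], which is contained in every [P^2]
    ([tails_module_cotorsion_countable]). *)

Set Implicit Arguments.
Unset Strict Implicit.
Unset Printing Implicit Defensive.

Import Order.TTheory GRing.Theory Num.Theory.
Local Open Scope classical_set_scope.
Local Open Scope ring_scope.

(** * Submodules, quotients and products *)

Section LinearOf.
Variables (R : comNzRingType) (U V : lmodType R) (f : U -> V).
Hypothesis fL : linear f.

Definition linear_of : U -> V := let _ := fL in f.

HB.instance Definition _ := GRing.isLinear.Build R U V _ linear_of fL.

Definition lin : {linear U -> V} := linear_of.

Lemma linE x : lin x = f x. Proof. by []. Qed.

End LinearOf.

Section LinearBasics.
Variable R : comNzRingType.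

Lemma lin0P (U V : lmodType R) (f : {linear U -> V}) :
  (forall x, f x = 0 -> x = 0) -> injective f.
Proof.
by move=> f0 x y fxy; apply/subr0_eq/f0; rewrite linearB /= fxy subrr.
Qed.

Lemma inj_eq0 (U V : lmodType R) (f : {linear U -> V}) x :
  injective f -> f x = 0 -> x = 0.
Proof. by move=> fI fx; apply: fI; rewrite fx linear0. Qed.

End LinearBasics.

Section SubQuot.
Variables (R : comNzRingType) (M : lmodType R).

Record submod := Submod {
  smem :> M -> Prop;
  submod0 : smem 0;
  submodL : forall a u v, smem u -> smem v -> smem (a *: u + v) }.

Lemma submodD (N : submod) u v : N u -> N v -> N (u + v).
Proof. by move=> Nu Nv; rewrite -[u]scale1r; apply: submodL. Qed.

Lemma submodZ (N : submod) a u : N u -> N (a *: u).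
Proof.
by move=> Nu; rewrite -[_ *: _]addr0; apply: submodL => //; apply: submod0.
Qed.

Lemma submodN (N : submod) u : N u -> N (- u).
Proof. by move=> Nu; rewrite -scaleN1r; apply: submodZ. Qed.

Lemma submodB (N : submod) u v : N u -> N v -> N (u - v).
Proof. by move=> Nu Nv; apply: submodD => //; apply: submodN. Qed.

Lemma submod_sum (N : submod) I (r : seq I) (P : pred I) (F : I -> M) :
  (forall i, P i -> N (F i)) -> N (\sum_(i <- r | P i) F i).
Proof.
move=> NF; apply: big_ind => //; first exact: submod0.
by move=> *; apply: submodD.
Qed.

Variable N : submod.

Record subm := Subm { sv : M; svP : N sv }.

Lemma sv_inj : injective sv.
Proof. by move=> [x Nx] [y Ny] /= xy; subst y; rewrite (Prop_irrelevance Nx Ny). Qed.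

HB.instance Definition _ := gen_eqMixin subm.
HB.instance Definition _ := gen_choiceMixin subm.

Let sadd (x y : subm) := Subm (submodD (svP x) (svP y)).
Let sopp (x : subm) := Subm (submodN (svP x)).
Let szero := Subm (submod0 N).
Let sscale a (x : subm) := Subm (submodZ a (svP x)).

Fact subm_addA : associative sadd.
Proof. by move=> x y z; apply: sv_inj; rewrite /= addrA. Qed.
Fact subm_addC : commutative sadd.
Proof. by move=> x y; apply: sv_inj; rewrite /= addrC. Qed.
Fact subm_add0 : left_id szero sadd.
Proof. by move=> x; apply: sv_inj; rewrite /= add0r. Qed.
Fact subm_addN : left_inverse szero sopp sadd.
Proof. by move=> x; apply: sv_inj; rewrite /= addNr. Qed.

HB.instance Definition _ :=
  GRing.isZmodule.Build subm subm_addA subm_addC subm_add0 subm_addN.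

Fact subm_scaleA a b x : sscale a (sscale b x) = sscale (a * b) x.
Proof. by apply: sv_inj; rewrite /= scalerA. Qed.
Fact subm_scale1 : left_id 1 sscale.
Proof. by move=> x; apply: sv_inj; rewrite /= scale1r. Qed.
Fact subm_scaleDr : right_distributive sscale +%R.
Proof. by move=> a x y; apply: sv_inj; rewrite /= scalerDr. Qed.
Fact subm_scaleDl x : {morph sscale^~ x : a b / a + b}.
Proof. by move=> a b; apply: sv_inj; rewrite /= scalerDl. Qed.

HB.instance Definition _ := GRing.Zmodule_isLmodule.Build R subm
  subm_scaleA subm_scale1 subm_scaleDr subm_scaleDl.

Fact sv_linear : linear sv. Proof. by []. Qed.
Definition incl : {linear subm -> M} := lin sv_linear.

Lemma incl_inj : injective incl. Proof. exact: sv_inj. Qed.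

(** A coset is represented by a chosen element, so that equality of cosets is
    equality of representatives. *)
Definition coset_rep (x : M) : M := xget 0 [set y | N (x - y)].

Lemma coset_repP x : N (x - coset_rep x).
Proof.
rewrite /coset_rep; case: xgetP => [y _ //|/(_ x)]; rewrite /= subrr.
by case; apply: submod0.
Qed.

Lemma coset_rep_eq x y : N (x - y) -> coset_rep x = coset_rep y.
Proof.
move=> Nxy; congr (xget 0 _); apply/seteqP; split=> z /= Nz.
  rewrite -[y](subKr x) -addrA [- _ - z]addrC addrA.
  exact: submodB.
by rewrite -[x](subrK y) -addrA; apply: submodD.
Qed.

Record quot := Quot { qrep : M; qrepP : coset_rep qrep = qrep }.

Lemma qrep_inj : injective qrep.
Proof. by move=> [x Nx] [y Ny] /= xy; subst y; rewrite (Prop_irrelevance Nx Ny). Qed.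

Fact coset_repK x : coset_rep (coset_rep x) = coset_rep x.
Proof.
apply/coset_rep_eq; rewrite -opprB; apply: submodN; exact: coset_repP.
Qed.

Definition cls x : quot := Quot (coset_repK x).

Lemma clsE x y : cls x = cls y <-> N (x - y).
Proof.
split=> [[e]|Nxy]; last by apply: qrep_inj; apply: coset_rep_eq.
have -> : x - y = (x - coset_rep x) - (y - coset_rep y) by rewrite e opprB addrA subrK.
by apply: submodB; exact: coset_repP.
Qed.

Lemma qrepK z : cls (qrep z) = z.
Proof. by apply: qrep_inj; rewrite /= qrepP. Qed.

HB.instance Definition _ := gen_eqMixin quot.
HB.instance Definition _ := gen_choiceMixin quot.

Let qadd (x y : quot) := cls (qrep x + qrep y).
Let qopp (x : quot) := cls (- qrep x).
Let qscale a (x : quot) := cls (a *: qrep x).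

Let qaddE x y : qadd (cls x) (cls y) = cls (x + y).
Proof.
apply/clsE; rewrite opprD addrACA /=; apply: submodD; rewrite -opprB;
  by apply: submodN; exact: coset_repP.
Qed.
Let qoppE x : qopp (cls x) = cls (- x).
Proof. by apply/clsE; rewrite opprK addrC /=; exact: coset_repP. Qed.
Let qscaleE a x : qscale a (cls x) = cls (a *: x).
Proof.
apply/clsE; rewrite -scalerBr; apply: submodZ; rewrite -opprB.
by apply: submodN; exact: coset_repP.
Qed.

Fact quot_addA : associative qadd.
Proof.
by move=> x y z; rewrite -[x]qrepK -[y]qrepK -[z]qrepK !qaddE addrA.
Qed.
Fact quot_addC : commutative qadd.
Proof. by move=> x y; rewrite /qadd addrC. Qed.
Fact quot_add0 : left_id (cls 0) qadd.
Proof. by move=> x; rewrite -[x]qrepK qaddE add0r. Qed.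
Fact quot_addN : left_inverse (cls 0) qopp qadd.
Proof. by move=> x; rewrite -[x]qrepK qoppE qaddE addNr. Qed.

HB.instance Definition _ :=
  GRing.isZmodule.Build quot quot_addA quot_addC quot_add0 quot_addN.

Fact quot_scaleA a b x : qscale a (qscale b x) = qscale (a * b) x.
Proof. by rewrite -[x]qrepK !qscaleE scalerA. Qed.
Fact quot_scale1 : left_id 1 qscale.
Proof. by move=> x; rewrite -[x]qrepK qscaleE scale1r. Qed.
Fact quot_scaleDr : right_distributive qscale +%R.
Proof.
move=> a x y; have addE u v : cls u + cls v = cls (u + v) by exact: qaddE.
by rewrite -[x]qrepK -[y]qrepK addE !qscaleE addE scalerDr.
Qed.
Fact quot_scaleDl x : {morph qscale^~ x : a b / a + b}.
Proof.
move=> a b; rewrite -[x]qrepK /= !qscaleE.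
have addE u v : cls u + cls v = cls (u + v) by exact: qaddE.
by rewrite addE scalerDl.
Qed.

HB.instance Definition _ := GRing.Zmodule_isLmodule.Build R quot
  quot_scaleA quot_scale1 quot_scaleDr quot_scaleDl.

Fact cls_linear : linear cls.
Proof.
move=> a x y; have addE u v : cls u + cls v = cls (u + v) by exact: qaddE.
have scaleE u : a *: cls u = cls (a *: u) by exact: qscaleE.
by rewrite scaleE addE.
Qed.
Definition proj : {linear M -> quot} := lin cls_linear.

Lemma proj_surj : surjective proj.
Proof. by move=> z; exists (qrep z); exact: qrepK. Qed.
Lemma proj_eq0 x : proj x = 0 <-> N x.
Proof. by rewrite -[0](linear0 proj) -{2}[x]subr0; exact: clsE. Qed.
Lemma proj_eq x y : proj x = proj y <-> N (x - y).
Proof. exact: clsE. Qed.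

End SubQuot.

Section Prod.
Variables (R : comNzRingType) (T : Type) (M : T -> lmodType R).

Definition dprod : Type := forall t, M t.

HB.instance Definition _ := gen_eqMixin dprod.
HB.instance Definition _ := gen_choiceMixin dprod.

Fact dprod_addA : associative (fun (f g : dprod) t => f t + g t).
Proof. by move=> f g h; apply: functional_extensionality_dep => t; rewrite addrA. Qed.
Fact dprod_addC : commutative (fun (f g : dprod) t => f t + g t).
Proof. by move=> f g; apply: functional_extensionality_dep => t; rewrite addrC. Qed.
Fact dprod_add0 : left_id (fun t => 0) (fun (f g : dprod) t => f t + g t).
Proof. by move=> f; apply: functional_extensionality_dep => t; rewrite add0r. Qed.
Fact dprod_addN : left_inverse (fun t => 0) (fun (f : dprod) t => - f t)
  (fun (f g : dprod) t => f t + g t).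
Proof. by move=> f; apply: functional_extensionality_dep => t; rewrite addNr. Qed.

HB.instance Definition _ :=
  GRing.isZmodule.Build dprod dprod_addA dprod_addC dprod_add0 dprod_addN.

Let dscale a (f : dprod) : dprod := fun t => a *: f t.

Fact dprod_scaleA a b x : dscale a (dscale b x) = dscale (a * b) x.
Proof. by apply: functional_extensionality_dep => t; rewrite /dscale scalerA. Qed.
Fact dprod_scale1 : left_id 1 dscale.
Proof. by move=> x; apply: functional_extensionality_dep => t; rewrite /dscale scale1r. Qed.
Fact dprod_scaleDr : right_distributive dscale +%R.
Proof. by move=> a x y; apply: functional_extensionality_dep => t; rewrite /dscale scalerDr. Qed.
Fact dprod_scaleDl x : {morph dscale^~ x : a b / a + b}.
Proof. by move=> a b; apply: functional_extensionality_dep => t; rewrite /dscale scalerDl. Qed.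

HB.instance Definition _ := GRing.Zmodule_isLmodule.Build R dprod
  dprod_scaleA dprod_scale1 dprod_scaleDr dprod_scaleDl.

Lemma dprodD (f g : dprod) t : (f + g) t = f t + g t. Proof. by []. Qed.
Lemma dprodZ a (f : dprod) t : (a *: f) t = a *: f t. Proof. by []. Qed.
Lemma dprodP (f g : dprod) : (forall t, f t = g t) -> f = g.
Proof. exact: functional_extensionality_dep. Qed.

End Prod.

Section Descend.
Variable R : comNzRingType.

Lemma descend (X Y Z : lmodType R) (q : {linear X -> Y}) (f : {linear X -> Z}) :
  surjective q -> (forall x, q x = 0 -> f x = 0) ->
  exists g : {linear Y -> Z}, forall x, g (q x) = f x.
Proof.
move=> qS qf.
have [s sK] := choice qS.
have sE x : f (s (q x)) = f x.
  by apply/subr0_eq; rewrite -linearB /=; apply: qf; rewrite linearB /= sK subrr.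
have gL : linear (f \o s).
  by move=> a u v /=; rewrite -linearP -(sE (a *: _ + _)) linearP /= !sK.
by exists (lin gL) => x; rewrite linE /= sE.
Qed.

Lemma factor_inj (A B X : lmodType R) (i : {linear A -> B}) (f : {linear X -> B}) :
  injective i -> (forall x, exists a, i a = f x) ->
  exists g : {linear X -> A}, forall x, i (g x) = f x.
Proof.
move=> iI fi; have [s sK] := choice fi.
have sL : linear s by move=> a u v; apply: iI; rewrite linearP /= !sK linearP.
by exists (lin sL) => x; rewrite linE sK.
Qed.

Fact ker_L (X Y : lmodType R) (f : {linear X -> Y}) a u v :
  f u = 0 -> f v = 0 -> f (a *: u + v) = 0.
Proof. by move=> fu fv; rewrite linearP /= fu fv scaler0 addr0. Qed.

Definition ker (X Y : lmodType R) (f : {linear X -> Y}) : submod X :=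
  Submod (linear0 f) (@ker_L X Y f).

Fact img_0 (X Y : lmodType R) (f : {linear X -> Y}) : exists x, f x = 0.
Proof. by exists 0; rewrite linear0. Qed.
Fact img_L (X Y : lmodType R) (f : {linear X -> Y}) a u v :
  (exists x, f x = u) -> (exists x, f x = v) -> exists x, f x = a *: u + v.
Proof. by move=> [x <-] [y <-]; exists (a *: x + y); rewrite linearP. Qed.

Definition img (X Y : lmodType R) (f : {linear X -> Y}) : submod Y :=
  Submod (img_0 f) (@img_L X Y f).

Lemma injective_ext (E X Y : lmodType R) (al : {linear X -> Y}) (f : {linear X -> E}) :
  injective_module E -> (forall x, al x = 0 -> f x = 0) ->
  exists g : {linear Y -> E}, forall x, g (al x) = f x.
Proof.
move=> Einj alf; set q := proj (ker al).
have qS : surjective q := @proj_surj _ _ _.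
have [f' f'E] : exists f' : {linear _ -> E}, forall x, f' (q x) = f x.
  by apply: (descend qS) => x /proj_eq0; exact: alf.
have [al' al'E] : exists al' : {linear _ -> Y}, forall x, al' (q x) = al x.
  by apply: (descend qS) => x /proj_eq0.
have al'I : injective al'.
  apply: lin0P => z; have [x <-] := qS z; rewrite al'E => alx.
  exact/proj_eq0.
have [g gE] := Einj _ _ _ f' al'I.
by exists g => x; rewrite -al'E -f'E -gE.
Qed.

End Descend.

(** * Enough injectives *)

Section Baer.
Variable R : comNzRingType.

(** A linear map from an ideal of [R] to [E] is given by its graph, which
    spares a module structure on ideals. *)
Definition baer (E : lmodType R) : Prop :=
  forall G : submod (R^o * E)%type, (forall e, G (0, e) -> e = 0) ->
  exists x, forall (r : R) e, G (r, e) -> e = r *: x.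

(** Baer's criterion: Zorn's lemma applies to the graphs of partial extensions,
    and the criterion adds any given element to the domain of one of them. *)
Lemma baer_injective (E : lmodType R) : baer E -> injective_module E.
Proof.
move=> bE A B i f iI.
pose good (G : set (B * E)) :=
  [/\ forall a u v, G u -> G v -> G (a *: u + v),
      forall e, G (0, e) -> e = 0 & forall a, G (i a, f a)].
pose P (G : set (B * E)) := G = set0 \/ good G.
have [F FP totF|G [PG maxG]] := @Zorn_bigcup _ P.
  have [[X FX [p Xp]]|nX] := pselect (exists2 X, F X & exists p, X p); last first.
    left; apply/seteqP; split=> // p [X FX Xp]; apply: nX.
    by exists X => //; exists p.
  have gF Y q : F Y -> Y q -> good Y.
    by move=> FY Yq; case: (FP Y FY) => // Y0; rewrite Y0 in Yq.
  right; split.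
  - move=> a u v [Y FY Yu] [Z FZ Zv].
    have [YZ|ZY] := totF _ _ FY FZ.
    + exists Z => //; have [lZ _ _] := gF _ _ FZ Zv.
      by apply: lZ => //; apply: YZ.
    + exists Y => //; have [lY _ _] := gF _ _ FY Yu.
      by apply: lY => //; apply: ZY.
  - by move=> e [Y FY Ye]; have [_ Yfun _] := gF _ _ FY Ye; exact: Yfun.
  - by move=> a; exists X => //; have [_ _ Xgr] := gF _ _ FX Xp; exact: Xgr.
have graph0 : good [set p : B * E | exists a, p = (i a, f a)].
  split.
  - move=> c _ _ [a ->] [b ->]; exists (c *: a + b).
    by rewrite !linearP.
  - by move=> e [a [/esym ia ->]]; rewrite (inj_eq0 iI ia) linear0.
  - by move=> a; exists a.
case: PG => [G0|[Glin Gfun Ggr]].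
  exfalso; apply: (maxG [set p : B * E | exists a, p = (i a, f a)]); last by right.
  rewrite G0; split=> // sub0; apply: (sub0 (i 0, f 0)).
  by exists 0.
have G0 : G (0, 0) by have := Ggr 0; rewrite !linear0.
have Gtot b : exists e, G (b, e).
  have H0 : G ((0 : R) *: b, 0) by rewrite scale0r.
  have HL a (u v : (R^o * E)%type) : G (u.1 *: b, u.2) -> G (v.1 *: b, v.2) ->
      G ((a *: u + v).1 *: b, (a *: u + v).2).
    move=> Gu Gv; have := Glin a _ _ Gu Gv.
    by congr (G (_, _)); rewrite /= scalerDl scalerA.
  have [|x xP] := bE (@Submod _ (R^o * E)%type (fun p => G (p.1 *: b, p.2)) H0 HL).
    by move=> e /=; rewrite scale0r; exact: Gfun.
  exists x.
  pose G' : set (B * E) := [set p | exists r q, G q /\ p = (q.1 + r *: b, q.2 + r *: x)].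
  have gG' : good G'.
    split.
    - move=> a _ _ [r [q [Gq ->]]] [s [t [Gt ->]]].
      exists (a * r + s), (a *: q + t); split; first exact: Glin.
      by congr (_, _); rewrite /= !scalerDr !scalerDl !scalerA addrACA.
    - move=> e [r [[q1 q2] [Gq [/= q0 ->]]]].
      have : G (r *: b, - q2).
        have := Glin (-1) _ _ Gq G0.
        congr (G (_, _)); rewrite /= addr0 scaleN1r //.
        by apply/eqP; rewrite eqr_oppLR -addr_eq0 -q0.
      by move/xP=> <-; rewrite subrr.
    - by move=> a; exists 0, (i a, f a); split; rewrite // !scale0r !addr0.
  have GG' : G `<=` G' by move=> [p q] Gp; exists 0, (p, q); split; rewrite // !scale0r !addr0.
  apply: contrapT => nGb.
  apply: (maxG G'); last by right.
  split=> // G'G; apply: nGb; apply: G'G.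
  by exists 1, (0, 0); split; rewrite // !scale1r !add0r.
have [g gP] := choice Gtot.
have Guniq b e e' : G (b, e) -> G (b, e') -> e = e'.
  move=> Ge Ge'; apply/subr0_eq/Gfun.
  have := Glin (-1) _ _ Ge' Ge; congr (G (_, _)); rewrite /= scaleN1r ?addNr //.
  by rewrite addrC.
have gL : linear g.
  by move=> a u v; apply: (Guniq _ _ _ (gP _)); exact: (Glin a (u, g u) (v, g v) (gP u) (gP v)).
exists (lin gL) => a /=; rewrite linE; exact: Guniq (gP _) (Ggr a).
Qed.

Lemma injective_prod (T : Type) (E : lmodType R) :
  injective_module E -> injective_module (T -> E).
Proof.
move=> Einj A B i f iI.
have ftL t : linear (fun a => f a t) by move=> a u v; rewrite linearP.
have [g gE] := choice (fun t => Einj _ _ i (lin (ftL t)) iI).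
have gL : linear (fun b t => g t b).
  by move=> a u v; apply/funext => t; rewrite linearP.
by exists (lin gL) => a; apply/funext => t; rewrite /= linE; exact: gE.
Qed.

End Baer.

Section RationalsModZ.

Let isint (q : rat) := exists n : int, q = n%:~R.
Fact isint0 : isint (0 : zmodule rat). Proof. by exists 0. Qed.
Fact isintL (a : int) (u v : zmodule rat) : isint u -> isint v -> isint (a *: u + v).
Proof.
move=> [m ->] [n ->]; exists (a * m + n).
by rewrite scalezrE rmorphD rmorphM /= mulrzl.
Qed.
Definition integers := Submod isint0 isintL.

Definition QmodZ := quot integers.

Lemma QmodZ_baer : baer QmodZ.
Proof.
move=> G Gfun.
have GB r e r' e' (k : int) : G (r, e) -> G (r', e') -> G (r - k * r', e - k *: e').
  move=> Ge Ge'; have := submodB Ge (submodZ k Ge').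
  by [].
have [[n /andP[/= n0 /asboolP[e0 Gn]] nmin]|nG] :=
  pselect (exists2 n : nat, (0 < n)%N && `[< exists e, G (n%:Z, e) >] &
     forall m : nat, (0 < m)%N && `[< exists e, G (m%:Z, e) >] -> (n <= m)%N).
  have [q qE] := @proj_surj _ _ integers e0.
  exists (proj integers ((q : rat) / n%:R)) => r e Gr.
  have Gm := GB _ _ _ _ (r %/ n)%Z Gr Gn.
  have m0 : (r %% n)%Z = 0.
    have [m mE] : exists m : nat, (r %% n)%Z = m by
      exists `|(r %% n)%Z|%N; rewrite gez0_abs // modz_ge0 //; lia.
    have mn : (m < n)%N by have := ltz_pmod r (d := n); rewrite mE; lia.
    case: (posnP m) => [m0|mpos]; first by rewrite mE m0.
    have := nmin m; rewrite mpos /= leqNgt mn; move=> /(_ _)/negP [] //.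
    apply/asboolP; exists (e - (r %/ n)%Z *: e0).
    by rewrite -mE; have := Gm; rewrite {1}(divz_eq r n) [_ + (_ %% _)%Z]addrC addrK.
  have rE : r = (r %/ n)%Z * n by rewrite {1}(divz_eq r n) m0 addr0.
  have -> : e = (r %/ n)%Z *: e0.
    by apply/subr0_eq/Gfun; have := Gm; rewrite {1}rE subrr.
  rewrite {2}rE -scalerA; congr (_ *: _).
  rewrite -qE -linearZ /=; congr (cls _ _); rewrite scalezrE.
  by rewrite -mulrzl -[n%:~R]/(n%:R) mulrC divfK // pnatr_eq0 -lt0n.
exists 0 => r e Gr; rewrite scaler0.
suff r0 : r = 0 by apply: Gfun; rewrite -r0.
apply: contrapT => /eqP rn0; apply: nG.
have ex : exists n : nat, (0 < n)%N && `[< exists e, G (n%:Z, e) >].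
  exists `|r|%N; rewrite absz_gt0 rn0 /=; apply/asboolP.
  case: (lerP 0 r) => [r0|/ltW r0]; first by exists e; rewrite gez0_abs.
  exists (- e); rewrite lez0_abs //; exact: submodN Gr.
by case: (ex_minnP ex) => n nP nmin; exists n.
Qed.

Lemma QmodZ_injective : injective_module QmodZ.
Proof. exact: baer_injective QmodZ_baer. Qed.

(** The value at [x] is [1/n] for [n] the order of [x], or [1/2] if that order is
    infinite. *)
Lemma QmodZ_cogenerator (V : lmodType int) (x : V) : x != 0 ->
  exists f : {linear V -> QmodZ}, f x != 0.
Proof.
move=> x0.
have alL : linear (fun k : int^o => k *: x).
  by move=> a u v; rewrite scalerDl scalerA.
have [n n2 nP] : exists2 n : nat, (2 <= n)%N & forall k : int, k *: x = 0 -> (n %| k)%Z.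
  have [ex|nex] := pselect (exists n : nat, (0 < n)%N && (n%:Z *: x == 0)).
    case: (ex_minnP ex) => n /andP[n0 /eqP nx] nmin; exists n.
      rewrite ltn_neqAle n0 andbT; apply/eqP => n1; move: x0.
      by rewrite -[x]scale1r -[1]/(1%:Z) n1 nx eqxx.
    move=> k kx; apply/dvdz_mod0P; apply: contrapT => /eqP kn.
    have [m mE] : exists m : nat, (k %% n)%Z = m by
      exists `|(k %% n)%Z|%N; rewrite gez0_abs // modz_ge0 //; lia.
    have mn : (m < n)%N by have := ltz_pmod k (d := n); rewrite mE; lia.
    have := nmin m; rewrite [(n <= m)%N]leqNgt mn => /(_ _)/negP [] //.
    apply/andP; split; first by rewrite lt0n; apply: contraNneq kn => m0; rewrite mE m0.
    rewrite -mE; move: kx; rewrite {1}(divz_eq k n) scalerDl -scalerA nx scaler0 add0r => ->.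
    by rewrite eqxx.
  exists 2%N => // k kx; suff -> : k = 0 by rewrite dvdz0.
  apply: contrapT => /eqP k0; apply: nex; exists `|k|%N; rewrite absz_gt0 k0 /=.
  case: (lerP 0 k) => [kp|/ltW kn]; first by rewrite gez0_abs // kx.
  by rewrite lez0_abs // scaleNr kx oppr0.
pose c : QmodZ := proj integers (n%:R^-1 : rat).
have fL : linear (fun k : int^o => k *: c).
  by move=> a u v; rewrite scalerDl scalerA.
have n0 : n%:R != 0 :> rat by rewrite pnatr_eq0; lia.
have nc : n%:Z *: c = 0.
  rewrite -linearZ /=; apply/proj_eq0; exists 1.
  by rewrite scalezrE -mulrzl -[n%:~R]/(n%:R) divff.
have [k /=|g gE] := injective_ext (al := lin alL) (f := lin fL) QmodZ_injective.
  rewrite !linE => /nP/dvdzP[m ->].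
  by rewrite -scalerA nc scaler0.
exists g; have := gE 1; rewrite !linE !scale1r => ->.
apply/eqP => /proj_eq0 [m mE].
have /eqP : (m * n)%:~R = 1 :> rat by rewrite rmorphM /= -mE mulVf.
rewrite -[1]/(1%:~R) eqr_int => /eqP mn1.
have : (`|m| * n)%N = 1%N by rewrite -[n in LHS]/`|n%:Z|%N -abszM mn1.
by move/eqP; rewrite muln_eq1 => /andP[_ /eqP]; lia.
Qed.

End RationalsModZ.

Section CharacterModule.
Variable R : comNzRingType.

(** The coinduced module [Hom_Z(R, Q/Z)], with [R] acting through its own
    multiplication: linear maps into it are additive maps into [Q/Z]. *)
Record charmod := CharMod {
  chfun :> R -> QmodZ;
  chfunD : forall x y, chfun (x + y) = chfun x + chfun y }.

Lemma charmodP (f g : charmod) : (forall x, f x = g x) -> f = g.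
Proof.
case: f g => f fD [g gD] /= fg; have e : f = g by apply/funext.
by subst g; rewrite (Prop_irrelevance fD gD).
Qed.

HB.instance Definition _ := gen_eqMixin charmod.
HB.instance Definition _ := gen_choiceMixin charmod.

Fact ch_addD (f g : charmod) x y : f (x + y) + g (x + y) = f x + g x + (f y + g y).
Proof. by rewrite !chfunD addrACA. Qed.
Fact ch_oppD (f : charmod) x y : - f (x + y) = - f x + - f y.
Proof. by rewrite chfunD opprD. Qed.
Fact ch_0D (x y : R) : (0 : QmodZ) = 0 + 0.
Proof. by rewrite addr0. Qed.
Fact ch_scaleD a (f : charmod) x y : f ((x + y) * a) = f (x * a) + f (y * a).
Proof. by rewrite mulrDl chfunD. Qed.

Let cadd (f g : charmod) := CharMod (ch_addD f g).
Let copp (f : charmod) := CharMod (ch_oppD f).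
Let czero := CharMod ch_0D.
Let cscale a (f : charmod) := CharMod (ch_scaleD a f).

Fact ch_addA : associative cadd.
Proof. by move=> x y z; apply: charmodP => t; rewrite /= addrA. Qed.
Fact ch_addC : commutative cadd.
Proof. by move=> x y; apply: charmodP => t; rewrite /= addrC. Qed.
Fact ch_add0 : left_id czero cadd.
Proof. by move=> x; apply: charmodP => t; rewrite /= add0r. Qed.
Fact ch_addN : left_inverse czero copp cadd.
Proof. by move=> x; apply: charmodP => t; rewrite /= addNr. Qed.

HB.instance Definition _ :=
  GRing.isZmodule.Build charmod ch_addA ch_addC ch_add0 ch_addN.

Fact ch_scaleA a b x : cscale a (cscale b x) = cscale (a * b) x.
Proof. by apply: charmodP => t; rewrite /= -mulrA. Qed.
Fact ch_scale1 : left_id 1 cscale.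
Proof. by move=> x; apply: charmodP => t; rewrite /= mulr1. Qed.
Fact ch_scaleDr : right_distributive cscale +%R.
Proof. by move=> a x y; apply: charmodP => t. Qed.
Fact ch_scaleDl x : {morph cscale^~ x : a b / a + b}.
Proof. by move=> a b; apply: charmodP => t; rewrite /= mulrDr chfunD. Qed.

HB.instance Definition _ := GRing.Zmodule_isLmodule.Build R charmod
  ch_scaleA ch_scale1 ch_scaleDr ch_scaleDl.

Lemma charmod_addE (f g : charmod) t : (f + g) t = f t + g t. Proof. by []. Qed.
Lemma charmod_scaleE a (f : charmod) t : (a *: f) t = f (t * a). Proof. by []. Qed.

Lemma charmod_lift (B : lmodType R) (chi : {linear zmodule B -> QmodZ}) :
  exists g : {linear B -> charmod}, forall (b : B) (r : R), g b r = chi (r *: b).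
Proof.
have gD (b : B) (x y : R) : chi ((x + y) *: b) = chi (x *: b) + chi (y *: b).
  by rewrite scalerDl -[LHS]/(chi ((x *: b : zmodule B) + y *: b)) linearD.
have gL : linear (fun b => CharMod (gD b)).
  move=> a u v; apply: charmodP => t; rewrite charmod_addE charmod_scaleE /=.
  rewrite scalerDr scalerA.
  by rewrite -[LHS]/(chi (((t * a) *: u : zmodule B) + t *: v)) linearD.
by exists (lin gL) => b r; rewrite linE.
Qed.

Lemma linear_int (U V : zmodType) (f : U -> V) :
  (forall x y, f (x + y) = f x + f y) -> linear (f : zmodule U -> zmodule V).
Proof.
move=> fD a u v; have f0 : f 0 = 0 by apply: (addrI (f 0)); rewrite -fD !addr0.
have fN x : f (- x) = - f x by apply: (addrI (f x)); rewrite -fD !subrr f0.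
rewrite fD !scalezrE; congr (_ + _).
have fn n : f (u *+ n) = f u *+ n.
  by elim: n => [|n IH]; rewrite ?mulr0n // !mulrS fD IH.
by case: a => n; rewrite ?NegzE /= ?mulrNz -!pmulrn ?fN fn.
Qed.

Lemma linear_QmodZ (U : zmodType) (f : U -> QmodZ) :
  (forall x y, f (x + y) = f x + f y) -> linear (f : zmodule U -> QmodZ).
Proof.
move=> fD a u v; have := linear_int fD a u v; rewrite !scalezrE => ->.
by rewrite -[a in RHS]intz scaler_int.
Qed.

Lemma charmod_injective : injective_module charmod.
Proof.
move=> A B i f iI.
have iD x y : i (x + y) = i x + i y by rewrite linearD.
have fD x y : f (x + y) 1 = f x 1 + f y 1 by rewrite linearD.
have [chi chiE] := QmodZ_injective (i := lin (linear_int iD)) (lin (linear_QmodZ fD)) iI.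
have [g gE] := charmod_lift chi.
exists g => a /=; apply: charmodP => r; rewrite gE.
have := chiE (r *: a); rewrite /= !linE linearZ /= => ->.
by rewrite linearZ charmod_scaleE mul1r.
Qed.

Lemma charmod_cogenerator (V : lmodType R) (x : V) : x != 0 ->
  exists f : {linear V -> charmod}, f x != 0.
Proof.
move=> x0; have [chi chix] := @QmodZ_cogenerator (zmodule V) x x0.
have [g gE] := charmod_lift chi; exists g.
apply: contraNneq chix => gx; apply/eqP.
by have := gE x 1; rewrite scale1r gx => <-.
Qed.

Lemma enough_injectives (V : lmodType R) :
  exists (E : lmodType R) (i : {linear V -> E}), injective_module E /\ injective i.
Proof.
pose E := {linear V -> charmod} -> charmod.
have iL : linear (fun v : V => (fun f => f v) : E).
  by move=> a u v; apply/funext => f; rewrite linearP.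
exists E, (lin iL); split; first exact: injective_prod charmod_injective.
apply: lin0P => v; rewrite linE => v0; apply: contrapT => /eqP /charmod_cogenerator[f].
by have /(congr1 (@^~ f)) /= -> := v0; rewrite eqxx.
Qed.

End CharacterModule.

(** * Direct sums and free modules *)

Section DirectSum.
Variables (R : comNzRingType) (X : choiceType) (V : lmodType R).

Definition fin_supp (f : X -> V) := exists s : seq X, forall x, x \notin s -> f x = 0.

Fact fin_supp0 : fin_supp 0. Proof. by exists [::]. Qed.
Fact fin_suppL a u v : fin_supp u -> fin_supp v -> fin_supp (a *: u + v).
Proof.
move=> [s us] [t vt]; exists (s ++ t) => x; rewrite mem_cat negb_or => /andP[xs xt].
by rewrite -[LHS]/(a *: u x + v x) us // vt // scaler0 addr0.
Qed.

Definition dsum := subm (Submod fin_supp0 fin_suppL).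

HB.instance Definition _ := GRing.Lmodule.on dsum.

Lemma dsumP (f g : dsum) : (forall x, sv f x = sv g x) -> f = g.
Proof. by move=> fg; apply: sv_inj; apply/funext. Qed.

Lemma dsum_addE (f g : dsum) x : sv (f + g) x = sv f x + sv g x. Proof. by []. Qed.
Lemma dsum_scaleE a (f : dsum) x : sv (a *: f) x = a *: sv f x. Proof. by []. Qed.

Definition dsupp (f : dsum) : seq X := undup (projT1 (cid (svP f))).

Lemma dsupp_uniq f : uniq (dsupp f). Proof. exact: undup_uniq. Qed.
Lemma dsuppP f x : x \notin dsupp f -> sv f x = 0.
Proof. by rewrite mem_undup; case: cid => /= s; apply. Qed.

Section Sum.
Variables (U : lmodType R) (phi : X -> {linear V -> U}).

Lemma dsum_sumE (f : dsum) (s t : seq X) : uniq s -> uniq t ->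
  (forall x, x \notin s -> sv f x = 0) -> (forall x, x \notin t -> sv f x = 0) ->
  \sum_(x <- s) phi x (sv f x) = \sum_(x <- t) phi x (sv f x).
Proof.
move=> us ut fs ft.
have restr r : \sum_(x <- r) phi x (sv f x) =
    \sum_(x <- [seq x <- r | sv f x != 0]) phi x (sv f x).
  rewrite big_filter [RHS]big_mkcond /=; apply: eq_bigr => x _.
  by case: eqP => //= ->; rewrite linear0.
rewrite restr [RHS]restr; apply: perm_big; apply: uniq_perm; rewrite ?filter_uniq // => x.
rewrite !mem_filter; case: eqP => //= fx.
have inr r : (forall x, x \notin r -> sv f x = 0) -> x \in r.
  by move=> fr; apply/negPn/negP => /fr.
by rewrite !inr.
Qed.

Definition dsum_fun (f : dsum) : U := \sum_(x <- dsupp f) phi x (sv f x).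

Lemma dsum_funE (f : dsum) s : uniq s -> (forall x, x \notin s -> sv f x = 0) ->
  dsum_fun f = \sum_(x <- s) phi x (sv f x).
Proof. by move=> us fs; apply: dsum_sumE; rewrite ?dsupp_uniq //; exact: dsuppP. Qed.

Fact dsum_linear : linear dsum_fun.
Proof.
move=> a u v; set s := undup (dsupp u ++ dsupp v).
have us : uniq s by exact: undup_uniq.
have su x : x \notin s -> sv u x = 0.
  by rewrite mem_undup mem_cat negb_or => /andP[/dsuppP].
have sv' x : x \notin s -> sv v x = 0.
  by rewrite mem_undup mem_cat negb_or => /andP[_ /dsuppP].
rewrite !(dsum_funE us) //; last by move=> x xs; rewrite dsum_addE dsum_scaleE su // sv' // scaler0 addr0.
rewrite scaler_sumr -big_split; apply: eq_bigr => x _ /=.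
by rewrite linearP.
Qed.

Definition dsum_map : {linear dsum -> U} := lin dsum_linear.

Lemma dsum_mapE (f : dsum) s : uniq s -> (forall x, x \notin s -> sv f x = 0) ->
  dsum_map f = \sum_(x <- s) phi x (sv f x).
Proof. exact: dsum_funE. Qed.

End Sum.

Fact single_supp x (v : V) : fin_supp (fun y => if y == x then v else 0).
Proof. by exists [:: x] => y; rewrite inE => /negbTE ->. Qed.

Fact single_linear x : linear (fun v => Subm (N := Submod fin_supp0 fin_suppL) (single_supp x v) : dsum).
Proof.
move=> a u v; apply: dsumP => y; rewrite dsum_addE dsum_scaleE /=.
by case: eqP => // _; rewrite scaler0 addr0.
Qed.

Definition single x : {linear V -> dsum} := lin (single_linear x).

Lemma singleE x v y : sv (single x v) y = if y == x then v else 0. Proof. by []. Qed.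

Lemma dsum_map_single (U : lmodType R) (phi : X -> {linear V -> U}) x v :
  dsum_map phi (single x v) = phi x v.
Proof.
rewrite (@dsum_mapE _ _ _ [:: x]) //; first by rewrite big_seq1 singleE eqxx.
by move=> y; rewrite inE singleE => /negbTE ->.
Qed.

Lemma dsum_decomp (f : dsum) : f = \sum_(x <- dsupp f) single x (sv f x).
Proof.
apply: dsumP => y.
have -> (s : seq X) : sv (\sum_(x <- s) single x (sv f x)) y =
    \sum_(x <- s) sv (single x (sv f x)) y.
  by elim: s => [|x s IH]; rewrite ?big_nil // !big_cons dsum_addE IH.
have [ys|ys] := boolP (y \in dsupp f); last first.
  rewrite dsuppP // big1_seq // => x /andP[_ xs]; rewrite singleE; case: eqP => // yx.
  by rewrite yx xs in ys.
rewrite (bigD1_seq y) ?dsupp_uniq // singleE eqxx big1 => [|x xy]; first by rewrite /= addr0.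
by rewrite singleE eq_sym (negbTE xy).
Qed.

End DirectSum.

Section Free.
Variables (R : comNzRingType) (X : choiceType).

Definition free := dsum X R^o.
HB.instance Definition _ := GRing.Lmodule.on free.

Definition fgen (x : X) : free := single R^o x 1.

Fact scale_linear (U : lmodType R) (u : U) : linear (fun r : R^o => r *: u).
Proof. by move=> a x y; rewrite scalerDl scalerA. Qed.
Definition scale_by (U : lmodType R) (u : U) : {linear R^o -> U} := lin (scale_linear u).

Definition free_map (U : lmodType R) (g : X -> U) : {linear free -> U} :=
  dsum_map (fun x => scale_by (g x)).

Lemma free_map_gen (U : lmodType R) (g : X -> U) x : free_map g (fgen x) = g x.
Proof. by rewrite /free_map dsum_map_single linE scale1r. Qed.

Lemma free_eq (U : lmodType R) (f g : {linear free -> U}) :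
  (forall x, f (fgen x) = g (fgen x)) -> f =1 g.
Proof.
move=> fg z; rewrite (dsum_decomp z) !linear_sum; apply: eq_bigr => x _.
have -> : single R^o x (sv z x) = sv z x *: (fgen x : free).
  by rewrite -linearZ /= -[_ *: _]/(_ * 1) mulr1.
by rewrite !linearZ /= fg.
Qed.

Lemma free_projective : projective_module free.
Proof.
move=> A B q f qS; have [s sK] := choice (fun x => qS (f (fgen x))).
exists (free_map s).
have qsL : linear (q \o free_map s) by move=> a u v; rewrite /= !linearP.
by apply: (@free_eq _ (lin qsL)) => x; rewrite linE /= free_map_gen.
Qed.

End Free.

Lemma free_cover (R : comNzRingType) (M : lmodType R) :
  surjective (free_map (fun x : M => x)).
Proof. by move=> x; exists (fgen _ x); rewrite free_map_gen. Qed.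

(** * Global dimension at most one *)

Section Resolutions.
Variable R : comNzRingType.

(** The extension of [A] by [F] is the pushout of a projective presentation of
    [F]; so maps out of it are governed by maps out of the presentation. *)
Lemma resolution_extend (A B F C : lmodType R) (P : projective_resolution F)
    (i : {linear A -> B}) (q : {linear B -> F}) (f : {linear A -> C}) :
  injective i -> surjective q -> (forall b, q b = 0 <-> exists a, i a = b) ->
  (forall u : {linear pr_mod P 1 -> C}, (forall x, u (pr_diff P 1 x) = 0) ->
     exists g : {linear pr_mod P 0 -> C}, forall x, u x = g (pr_diff P 0 x)) ->
  exists h : {linear B -> C}, forall a, h (i a) = f a.
Proof.
move=> iI qS qi cocycle.
have [l lE] := @pr_projective _ _ P 0%N _ _ q (pr_aug P) qS.
have [k kE] : exists k : {linear pr_mod P 1 -> A}, forall x, i (k x) = l (pr_diff P 0 x).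
  apply: (factor_inj (f := l \o pr_diff P 0) iI) => x; apply/qi.
  by have /= -> := lE (pr_diff P 0 x); apply/pr_exact0; exists x.
have [|g gE] := cocycle (f \o k).
  move=> x /=; rewrite (_ : k _ = 0) ?linear0 //; apply: (inj_eq0 iI).
  by rewrite kE (_ : pr_diff P 0 _ = 0) ?linear0 //; apply/pr_exactS; exists x.
have sL : linear (fun p : A * pr_mod P 0 => i p.1 + l p.2).
  by move=> a u v; rewrite !linearP /= scalerDr addrACA.
have tL : linear (fun p : A * pr_mod P 0 => f p.1 + g p.2).
  by move=> a u v; rewrite !linearP /= scalerDr addrACA.
have [||h hE] := descend (q := lin sL) (f := lin tL).
- move=> b; have [p pE] := pr_aug_surj P (q b).
  have /qi[a aE] : q (b - l p) = 0 by rewrite linearB /= -pE; have /= -> := lE p; rewrite subrr.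
  by exists (a, p); rewrite linE /= aE subrK.
- move=> [a p]; rewrite !linE /= => alp.
  have /pr_exact0[x xp] : pr_aug P p = 0.
    have /= <- := lE p; have := congr1 q alp; rewrite linearD linear0 /=.
    by have /qi -> : exists a', i a' = i a by [exists a]; rewrite add0r.
  have -> : a = - k x.
    by apply: iI; rewrite linearN /= kE xp; apply/eqP; rewrite -addr_eq0 alp.
  by rewrite linearN -xp -gE /= addNr.
exists h => a; have := hE (a, 0); rewrite !linE /= !linear0 !addr0; exact.
Qed.

Definition quotients_injective : Prop :=
  forall (E E' : lmodType R) (p : {linear E -> E'}),
    injective_module E -> surjective p -> injective_module E'.

Lemma gldim1_quotients_injective : gldim_le R 1 -> quotients_injective.
Proof.
move=> gl E E' p Einj pS A B i f iI.
have [P P0] := gl (quot (img i)).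
have qE b : proj (img i) b = 0 <-> exists a, i a = b by exact: proj_eq0.
have [u _|h hE] := resolution_extend (P := P) f iI (@proj_surj _ _ _) qE; last by exists h.
have d0I : injective (pr_diff P 0).
  by apply: lin0P => x /pr_exactS[y <-]; rewrite (P0 2%N isT y) linear0.
have [v vE] := @pr_projective _ _ P 1%N _ _ p u pS.
have [g gE] := Einj _ _ _ v d0I.
by exists (p \o g) => x /=; have /= -> := gE x; have /= -> := vE x.
Qed.

(** Dually to Baer's criterion: to lift [f] along [A -> B], embed [A] in an
    injective [E] and [B] in a quotient of [E]; the composite extends to [P],
    lifts to [E], and then lands in [A] on [K]. *)
Lemma submodule_projective (P : lmodType R) (K : submod P) :
  quotients_injective -> projective_module P -> projective_module (subm K).
Proof.
move=> qi Pproj A B q f qS.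
have [E [j [Einj jI]]] := enough_injectives A.
pose N : {linear subm (ker q) -> E} := j \o incl (ker q).
pose E' := quot (img N); pose p := proj (img N).
have E'inj : injective_module E' by apply: (qi _ _ p Einj); exact: proj_surj.
have [|b bE] := descend (q := q) (f := p \o j) qS.
  by move=> x qx; apply/proj_eq0; exists (Subm (N := ker q) qx).
have bI : injective b.
  apply: lin0P => y; have [a <-] := qS y; rewrite bE => /proj_eq0 [z /jI <-].
  exact: svP z.
have [g gE] := E'inj _ _ (incl K) (b \o f) (@incl_inj _ _ _).
have [g' g'E] := Pproj _ _ p g (@proj_surj _ _ _).
have [t tE] : exists t : {linear subm K -> A}, forall z, j (t z) = g' (incl K z).
  apply: (factor_inj (f := g' \o incl K) jI) => z; have [a aE] := qS (f z).
  have : p (g' (incl K z)) = p (j a).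
    by have /= -> := g'E (incl K z); have /= -> := gE z; rewrite -aE bE.
  move=> /proj_eq [n nE]; exists (a + incl (ker q) n); rewrite linearD /=.
  have -> : j (sv n) = g' (incl K z) - j a by exact: nE.
  by rewrite addrC subrK.
exists t => z /=; apply: bI; rewrite bE /= tE.
by have /= -> := g'E (incl K z); have /= -> := gE z.
Qed.

Fact zero_L a (u v : R^o) : u = 0 -> v = 0 -> a *: u + v = 0.
Proof. by move=> -> ->; rewrite scaler0 addr0. Qed.
Definition zero_module : lmodType R := subm (Submod (erefl (0 : R^o)) zero_L).

Lemma zero_moduleP (x : zero_module) : x = 0.
Proof. by apply: sv_inj; rewrite (svP x). Qed.

Lemma zero_projective : projective_module zero_module.
Proof.
move=> A B q f _.
have zL : linear (fun _ : zero_module => 0 : A) by move=> a u v; rewrite scaler0 addr0.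
by exists (lin zL) => z; rewrite (zero_moduleP z) !linear0.
Qed.

Lemma quotients_injective_gldim1 : quotients_injective -> gldim_le R 1.
Proof.
move=> qi M; pose e : {linear free R M -> M} := free_map (fun x : M => x).
pose mods n : lmodType R :=
  match n with 0 => free R M | 1 => subm (ker e) | _ => zero_module end.
have zL (U V : lmodType R) : linear (fun _ : U => 0 : V).
  by move=> a u v; rewrite scaler0 addr0.
pose diff n : {linear mods n.+1 -> mods n} :=
  match n with 0 => incl (ker e) | n.+1 => lin (zL (mods n.+2) (mods n.+1)) end.
have Pr n : projective_module (mods n).
  case: n => [|[|n]]; [exact: free_projective| |exact: zero_projective].
  exact: submodule_projective qi (@free_projective _ _).
have ex0 x : e x = 0 <-> exists y, diff 0%N y = x.
  split=> [ex|[y <-]]; [by exists (Subm (N := ker e) ex) | exact: svP y].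
have exS n x : diff n x = 0 <-> exists y, diff n.+1 y = x.
  split=> [dx|[y <-]]; last by rewrite [diff n.+1 y]linE linear0.
  exists 0; rewrite linE; case: n x dx => [|n] x dx; last by rewrite [RHS]zero_moduleP.
  by apply/esym/(inj_eq0 (@incl_inj _ _ _) dx).
exists (ProjectiveResolution Pr (@free_cover _ _) ex0 exS) => k k1 x.
by case: k k1 x => [|[|k]] // _ x; exact: zero_moduleP.
Qed.

End Resolutions.

Section DualBases.
Variable R : comNzRingType.

Lemma noetherian_fg (I : submod R^o) : noetherian R ->
  exists (n : nat) (g : 'I_n -> R), (forall k, I (g k)) /\
    forall x, I x -> exists c : 'I_n -> R, x = \sum_(k < n) c k * g k.
Proof.
move=> noeth; have [|n [g gP]] := noeth [set x | I x].
  split=> [|a u v]; first by rewrite inE; exact: (submod0 I).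
  by rewrite !inE; exact: submodL.
exists n, g; split=> [k|x /gP //]; apply/gP; exists (fun j => (j == k)%:R).
rewrite (bigD1 k) //= eqxx mul1r big1 ?addr0 // => j /negbTE ->.
by rewrite mul0r.
Qed.

Definition dual_basis (I : submod R^o) : Prop :=
  exists (n : nat) (a : 'I_n -> R) (psi : 'I_n -> R -> R),
    [/\ forall k, I (a k),
        forall k (c x y : R), I x -> I y -> psi k (c * x + y) = c * psi k x + psi k y
      & forall x : R, I x -> x = \sum_(k < n) psi k x * a k].

Definition hereditary : Prop := forall I : submod R^o, dual_basis I.

Section Relations.
Variables (n : nat) (g : 'I_n -> R).

Fact comb_linear : linear (fun v : 'I_n -> R^o => \sum_(k < n) v k * g k : R^o).
Proof.
move=> a u v; rewrite scaler_sumr -big_split; apply: eq_bigr => k _ /=.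
by rewrite -[(a *: u + v) k]/(a * u k + v k) mulrDl -mulrA.
Qed.
Definition comb : {linear ('I_n -> R^o) -> R^o} := lin comb_linear.

Lemma combE v : comb v = \sum_(k < n) v k * g k. Proof. by []. Qed.

(** Coefficients expressing an element of [I] in the generators are determined
    up to relations; subtracting their image under the retraction [rho] onto the
    relations makes them unique, hence linear. *)
Lemma retraction_dual_basis (I : submod R^o) (rho : {linear ('I_n -> R^o) -> subm (ker comb)}) :
  (forall k, I (g k)) ->
  (forall x, I x -> exists c : 'I_n -> R, x = \sum_(k < n) c k * g k) ->
  (forall z, rho (sv z) = z) -> dual_basis I.
Proof.
move=> Ig gI rhoK.
have [c cE] : {c : R -> 'I_n -> R^o & forall x, I x -> x = comb (c x)}.
  apply: (@choice _ _ (fun x c => I x -> x = comb c)) => x.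
  by have [/gI[c ->]|nI] := pselect (I x); [exists c | exists 0].
exists n, g, (fun k x => c x k - sv (rho (c x)) k); split=> // [k a x y Ix Iy|x Ix].
  have Ixy : I (a * x + y) by exact: submodL.
  have Kz : ker comb (c (a * x + y) - (a *: c x + c y)).
    by rewrite /= linearB linearP /= -!cE // subrr.
  have /(congr1 (fun z => sv z k)) := rhoK (Subm Kz).
  rewrite linearB linearP /= => e; have {}e :
      sv (rho (c (a * x + y))) k - (a * sv (rho (c x)) k + sv (rho (c y)) k) =
      c (a * x + y) k - (a * c x k + c y k) by exact: e.
  have -> : c (a * x + y) k = sv (rho (c (a * x + y))) k -
      (a * sv (rho (c x)) k + sv (rho (c y)) k) + (a * c x k + c y k).
    by rewrite e subrK.
  by ring.
under eq_bigr => k _ do rewrite mulrBl.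
rewrite sumrB -combE -[X in _ - X]combE -cE //.
by have /= -> := svP (rho (c x)); rewrite subr0.
Qed.

End Relations.

(** Embed the relation module [K] into an injective [E].  The inclusion extends
    to the free module, and the induced map from the ideal to [E / K] extends
    to [R], hence is multiplication by the class of some [w]; subtracting the
    multiples of [w] leaves a map into [K]. *)
Lemma quotients_injective_hereditary :
  noetherian R -> quotients_injective R -> hereditary.
Proof.
move=> noeth qi I; have [n [g [Ig gI]]] := noetherian_fg I noeth.
pose al := comb g; pose K := ker al.
have [E [j [Einj jI]]] := enough_injectives (subm K).
have [g0 g0E] := Einj _ _ (incl K) j (@incl_inj _ _ _).
pose p := proj (img j).
have E'inj : injective_module (quot (img j)) by apply: (qi _ _ p Einj); exact: proj_surj.
have [v alv|h hE] := injective_ext (al := al) (f := p \o g0) E'inj.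
  by apply/proj_eq0; exists (Subm (N := K) alv); rewrite -g0E.
have [w wE] := @proj_surj _ _ (img j) (h 1).
have rL : linear (fun v => g0 v - al v *: w).
  by move=> a u v; rewrite !linearP /= scalerDl opprD addrACA scalerBr scalerA.
have [|rho rhoE] := factor_inj (f := lin rL) jI.
  move=> v; rewrite linE; suff /proj_eq0 : p (g0 v - al v *: w) = 0 by [].
  rewrite linearB linearZ /= wE; have /= <- := hE v.
  by apply/eqP; rewrite subr_eq0 -linearZ /= -[al v *: _]/(_ * 1) mulr1.
apply: (retraction_dual_basis (rho := rho) Ig gI) => z; apply: jI.
rewrite rhoE linE.
have -> : al (sv z) = 0 by exact: svP z.
by rewrite scale0r subr0; exact: g0E.
Qed.

(** Baer's criterion for [E']: coordinates lift a map from an ideal to [E'] along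
    [p], and the lift extends to [R] by injectivity of [E]. *)
Lemma hereditary_quotients_injective : hereditary -> quotients_injective R.
Proof.
move=> her E E' p Einj pS; apply: baer_injective => G Gfun.
have I0 : exists e, G (0 : R^o, e) by exists 0; exact: submod0.
have IL a (u v : R^o) : (exists e, G (u, e)) -> (exists e, G (v, e)) ->
    exists e, G (a *: u + v, e).
  by move=> [e Ge] [e' Ge']; exists (a *: e + e'); exact: submodL Ge Ge'.
have [n [a [psi [Ia psiL aI]]]] := her (Submod I0 IL).
have [e' Ge'] := choice Ia.
have [e eE] := choice (fun k => pS (e' k)).
have fL : linear (fun z : subm (Submod I0 IL) => \sum_(k < n) psi k (sv z) *: e k).
  move=> c u v; rewrite scaler_sumr -big_split; apply: eq_bigr => k _ /=.
  by rewrite [psi _ _]psiL ?scalerDl ?scalerA //; exact: svP.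
have [h hE] := Einj _ _ (incl _) (lin fL) (@incl_inj _ _ _).
exists (p (h 1)) => r y Gr.
have Ir : (Submod I0 IL) r by exists y.
have : G (r, \sum_(k < n) psi k r *: e' k).
  have -> : (r, \sum_(k < n) psi k r *: e' k) =
      \sum_(k < n) psi k r *: ((a k, e' k) : (R^o * E')%type).
    rewrite {1}[r]aI //.
    elim/big_rec3: _ => //= k u1 u2 u3 _ <-.
    by [].
  by apply: submod_sum => k _; apply: submodZ.
have -> : \sum_(k < n) psi k r *: e' k = r *: p (h 1).
  rewrite -!linearZ /= -[r *: (1 : R^o)]/(r * 1) mulr1.
  have := hE (Subm Ir); rewrite /= linE /= => ->.
  by rewrite linear_sum; apply: eq_bigr => k _; rewrite linearZ /= eE.
move=> Gr'; apply/subr0_eq/Gfun; have := submodB Gr Gr'.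
by congr (G (_, _)); rewrite /= subrr.
Qed.

End DualBases.

(** * Torsion-free, divisible and flat modules over hereditary rings *)

Section Regular.
Variable R : comNzRingType.

Definition regular (s : R) : Prop := forall r, s * r = 0 -> r = 0.

Lemma regularM s t : regular s -> regular t -> regular (s * t).
Proof. by move=> rs rt r; rewrite -mulrA => /rs/rt. Qed.

Lemma regular1 : regular 1. Proof. by move=> r; rewrite mul1r. Qed.

Definition torsion_free (M : lmodType R) : Prop :=
  forall s (x : M), regular s -> s *: x = 0 -> x = 0.

Definition divisible (M : lmodType R) : Prop :=
  forall s (x : M), regular s -> exists y, s *: y = x.

Lemma injective_divisible (E : lmodType R) : injective_module E -> divisible E.
Proof.
move=> Einj s x rs; have mI : injective (scale_by (s : R^o)).
  by apply: lin0P => r; rewrite linE -[_ *: _]/(_ * _) mulrC => /rs.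
have [g gE] := Einj _ _ _ (scale_by x) mI.
exists (g 1); have := gE 1; rewrite /= !linE !scale1r => <-.
by rewrite -linearZ /= -[s *: _]/(s * _) mulr1.
Qed.

Section DualBasis.
Variables (I : submod R^o) (n : nat) (a : 'I_n -> R) (psi : 'I_n -> R -> R).
Hypothesis psiL : forall k (c x y : R), I x -> I y -> psi k (c * x + y) = c * psi k x + psi k y.

Lemma coord0 k : psi k 0 = 0.
Proof.
have I0 : I 0 := submod0 I.
by have := psiL k (-1) I0 I0; rewrite mulr0 addr0 mulN1r addNr.
Qed.

Lemma coordZ k c x : I x -> psi k (c * x) = c * psi k x.
Proof. by move=> Ix; have := psiL k c Ix (submod0 I); rewrite !addr0 coord0 addr0. Qed.

Lemma coordC k x y : I x -> I y -> y * psi k x = x * psi k y.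
Proof. by move=> Ix Iy; rewrite -!coordZ // mulrC. Qed.

Lemma coord_sum k m (F : 'I_m -> R) : (forall i, I (F i)) ->
  psi k (\sum_(i < m) F i) = \sum_(i < m) psi k (F i).
Proof.
move=> IF; suff [] : I (\sum_(i < m) F i) /\
  psi k (\sum_(i < m) F i) = \sum_(i < m) psi k (F i) by [].
elim/big_rec2: _ => [|i y1 y2 _ [Iy e]]; first by rewrite coord0; split=> //; exact: submod0.
split; first exact: (submodD (N := I)).
by have := psiL k 1 (IF i) Iy; rewrite !mul1r e.
Qed.

Hypothesis Ia : forall k, I (a k).
Hypothesis aI : forall x : R, I x -> x = \sum_(k < n) psi k x * a k.

(** As [psi_k(x) y = psi_k(y) x] on [I], the expansion of [x] in the [a_k] can be
    read with the roles of [x] and [a_k] exchanged. *)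
Lemma trace_dual_basis x : I x -> x * \sum_(k < n) psi k (a k) = x.
Proof.
move=> Ix; rewrite [RHS]aI // mulr_sumr; apply: eq_bigr => k _.
by rewrite coordC // mulrC.
Qed.

Lemma trace_regular s : I s -> regular s -> \sum_(k < n) psi k (a k) = 1.
Proof.
move=> Is rs; apply/subr0_eq/rs; rewrite mulrBr mulr1 trace_dual_basis //.
by rewrite subrr.
Qed.

End DualBasis.

(** The idempotent is [1 - t], for [t] the trace of a dual basis of [(z)]. *)
Lemma ann_idempotent (z : R) : hereditary R ->
  exists e : R, [/\ e * e = e, e * z = 0 & forall r, r * z = 0 -> r = r * e].
Proof.
move=> her; have [n [a [psi [Ia psiL aI]]]] := her (img (scale_by (z : R^o))).
set I := img _ in Ia psiL aI.
have Iz : I z by exists 1; rewrite linE scale1r.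
set t := \sum_(k < n) psi k (a k).
have rt r : r * z = 0 -> r * t = 0.
  move=> rz; rewrite mulr_sumr big1 // => k _; rewrite -(coordZ psiL) //.
  have [c <-] := Ia k; rewrite linE -[_ *: _]/(_ * _) mulrCA rz mulr0.
  exact: coord0 psiL k.
have tz : (1 - t) * z = 0.
  by rewrite mulrBl mul1r [t * z]mulrC (trace_dual_basis psiL) // subrr.
exists (1 - t); split=> // [|r rz]; last by rewrite mulrBr mulr1 rt // subr0.
by rewrite mulrBr mulr1 rt // subr0.
Qed.

(** By induction on the generators: when [x] and [e] serve for the first ones
    and [z] is the next, [x + e z] and [e f] serve with it, where [f] is the
    idempotent that generates the annihilator of [e z]. *)
Lemma regular_complement (I : submod R^o) : noetherian R -> hereditary R ->
  exists x e : R, [/\ I x, e * e = e, forall y : R, I y -> e * y = 0 & regular (x + e)].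
Proof.
move=> noeth her; have [n [g [Ig gI]]] := noetherian_fg I noeth.
suff [x [e [Ix ee eg rxe]]] : exists x e : R, [/\ I x, e * e = e,
    forall k : 'I_n, e * g k = 0 & regular (x + e)].
  exists x, e; split=> // y /gI[c ->]; rewrite mulr_sumr big1 // => k _.
  by rewrite mulrCA eg mulr0.
suff step m : (m <= n)%N -> exists x e : R, [/\ I x, e * e = e, e * x = 0,
    forall k : 'I_n, (k < m)%N -> e * g k = 0 & regular (x + e)].
  have [x [e [Ix ee ex eg rxe]]] := step n (leqnn n).
  by exists x, e; split=> // k; exact: eg.
elim: m => [_|m IH mn].
  exists 0, 1; rewrite !mulr1 mul1r add0r; split=> //; first exact: (submod0 I).
  exact: regular1.
have [x [e [Ix ee ex eg rxe]]] := IH (ltnW mn).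
set z := g (Ordinal mn).
have [f [ff fz fmax]] := ann_idempotent (e * z) her.
exists (x + e * z), (e * f); split.
- by apply: (submodD (N := I)) => //; apply: (submodZ (N := I)); exact: Ig.
- by rewrite mulrACA ee ff.
- by rewrite mulrDr mulrAC ex mul0r add0r -mulrA [f * _]fz mulr0.
- move=> k; rewrite ltnS leq_eqVlt => /orP[/eqP km|km].
    by have -> : k = Ordinal mn; [exact: val_inj | rewrite mulrAC [_ * f]mulrC fz].
  by rewrite mulrAC eg // mul0r.
- move=> r r0.
  have rez : r * (e * z) + r * (e * f) = 0.
    have -> : r * (e * z) + r * (e * f) =
        e * ((x + e * z + e * f) * r) - (e * x) * r + (e - e * e) * (z + f) * r by ring.
    by rewrite r0 ex ee; ring.
  have ref : r * (e * f) = 0.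
    have -> : r * (e * f) = f * (r * (e * z) + r * (e * f)) -
        (f * (e * z)) * r + (f - f * f) * e * r by ring.
    by rewrite rez fz ff; ring.
  have rf : r = r * f by apply: fmax; move: rez; rewrite ref addr0.
  have re : r * e = 0 by rewrite rf mulrAC -mulrA.
  apply: rxe; have -> : (x + e) * r = (x + e * z + e * f) * r -
     (r * e) * z - r * (e * f) + r * e by ring.
  by rewrite r0 ref re; ring.
Qed.
End Regular.

Section Flat.
Variable R : comNzRingType.

(** On a module on which regular elements are invertible, a map [phi] from an
    ideal satisfies [(x + e) phi(a) = a phi(x)], with [x] and [e] as in
    [regular_complement], so it is multiplication by [phi(x) / (x + e)]. *)
Lemma invertible_injective (M : lmodType R) : noetherian R -> hereditary R ->
  torsion_free M -> divisible M -> injective_module M.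
Proof.
move=> noeth her tf dv; apply: baer_injective => G Gfun.
have I0 : exists e, G (0 : R^o, e) by exists 0; exact: submod0.
have IL a (u v : R^o) : (exists e, G (u, e)) -> (exists e, G (v, e)) ->
    exists e, G (a *: u + v, e).
  by move=> [e Ge] [e' Ge']; exists (a *: e + e'); exact: submodL Ge Ge'.
have [x [e [[y Gxy] ee eI rxe]]] := regular_complement (Submod I0 IL) noeth her.
have [z zE] := dv _ y rxe.
exists z => r m Grm; apply/subr0_eq/(tf _ _ rxe).
have er : e * r = 0 by apply: eI; exists m.
have em : e *: m = 0.
  apply: Gfun; have := submodZ e Grm; congr (G (_, _)).
  exact: er.
rewrite scalerBr scalerA mulrC -scalerA zE scalerDl em addr0.
apply: Gfun; have := submodB (submodZ x Grm) (submodZ r Gxy); congr (G (_, _)).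
by rewrite /= -[X in X - _]/(x * r) -[X in _ - X]/(r * x) mulrC subrr.
Qed.

Section Hom.
Variables A B : lmodType R.

Fact hom0 : linear (0 : A -> B).
Proof. by move=> a u v; rewrite -[LHS]/0 -[RHS]/(a *: 0 + 0) scaler0 addr0. Qed.
Fact homL a (f g : A -> B) : linear f -> linear g -> linear (a *: f + g).
Proof.
move=> fL gL c u v; rewrite -![(a *: f + g) _]/(a *: f _ + g _) fL gL.
by rewrite !scalerDr !scalerA addrACA mulrC.
Qed.

Definition hom := subm (Submod (smem := fun f : A -> B => linear f) hom0 homL).
HB.instance Definition _ := GRing.Lmodule.on hom.

Definition app (f : hom) : {linear A -> B} := lin (svP f).
Definition to_hom (f : {linear A -> B}) : hom :=
  Subm (N := Submod (smem := fun f : A -> B => linear f) hom0 homL) (fun a u v => linearP f a u v).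

Lemma to_homK f x : app (to_hom f) x = f x. Proof. by []. Qed.
Lemma homP (f g : hom) : (forall x, app f x = app g x) -> f = g.
Proof. by move=> fg; apply: sv_inj; apply/funext. Qed.
Lemma app_linear a (f g : hom) x : app (a *: f + g) x = a *: app f x + app g x.
Proof. by []. Qed.
Lemma app0 x : app 0 x = 0. Proof. by []. Qed.
Lemma appB (f g : hom) x : app (f - g) x = app f x - app g x. Proof. by []. Qed.
Lemma appD (f g : hom) x : app (f + g) x = app f x + app g x. Proof. by []. Qed.
Lemma appZ a (f : hom) x : app (a *: f) x = a *: app f x. Proof. by []. Qed.

End Hom.

Section BilinearOf.
Variables (A B C : lmodType R) (f : A -> B -> C).
Hypothesis fL : bilinear_for *:%R *:%R f.

Definition bilinear_of : A -> B -> C := let _ := fL in f.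
HB.instance Definition _ := bilinear_isBilinear.Build R A B C *:%R *:%R bilinear_of fL.
Definition bilin : {bilinear A -> B -> C} := bilinear_of.
Lemma bilinE x y : bilin x y = f x y. Proof. by []. Qed.
End BilinearOf.

Lemma hom_bilinear (A B C : lmodType R) (f : {linear B -> hom A C}) :
  bilinear_for *:%R *:%R (fun a b => app (f b) a).
Proof. by split=> [b|a] c u v; rewrite !linearP. Qed.

Lemma bilinear_hom (A B C : lmodType R) (f : {bilinear A -> B -> C}) :
  exists g : {linear B -> hom A C}, forall a b, app (g b) a = f a b.
Proof.
have fl b : linear (f^~ b).
  by move=> c u v; rewrite linearDl linearZl_LR.
have gL : linear (fun b => to_hom (lin (fl b))).
  move=> c u v; apply: homP => a; rewrite app_linear !to_homK /=; exact: (linearPr f a c u v).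
by exists (lin gL) => a b; rewrite linE to_homK.
Qed.

(** Extending a map [phi] from an ideal with generators [a_k] to [Hom(M, E)]
    amounts to extending [sum_k a_k m_k |-> sum_k phi(a_k)(m_k)] from [I M] to
    [M]; torsion-freeness makes it well defined. *)
Lemma hom_torsion_free_injective (M E : lmodType R) :
  noetherian R -> hereditary R -> torsion_free M -> injective_module E ->
  injective_module (hom M E).
Proof.
move=> noeth her tf Einj; apply: baer_injective => G Gfun.
have I0 : exists e, G (0 : R^o, e) by exists 0; exact: submod0.
have IL a (u v : R^o) : (exists e, G (u, e)) -> (exists e, G (v, e)) ->
    exists e, G (a *: u + v, e).
  by move=> [e Ge] [e' Ge']; exists (a *: e + e'); exact: submodL Ge Ge'.
set I := Submod I0 IL.
have [x [e [Ix ee eI rxe]]] := regular_complement I noeth her.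
have [n [a [psi [Ia psiL aI]]]] := her I.
have [ph phG] := choice Ia.
have Gsum m (r : 'I_m -> R) (s : 'I_m -> R) (h : 'I_m -> hom M E) :
    (forall k, G (s k, h k)) -> G (\sum_(k < m) r k * s k, \sum_(k < m) r k *: h k).
  move=> Gs; have -> : (\sum_(k < m) r k * s k, \sum_(k < m) r k *: h k) =
      \sum_(k < m) r k *: ((s k, h k) : (R^o * hom M E)%type).
    by elim/big_rec3: _ => //= k u1 u2 u3 _ <-.
  by apply: submod_sum => k _; apply: submodZ.
have Guniq r h h' : G (r, h) -> G (r, h') -> h = h'.
  move=> Gr Gr'; apply/subr0_eq/Gfun; have := submodB Gr Gr'.
  by congr (G (_, _)); rewrite /= subrr.
have phE r h : G (r, h) -> h = \sum_(k < n) psi k r *: ph k.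
  move=> Gr; apply: (Guniq r) => //; rewrite {1}[r]aI; last by exists h.
  exact: Gsum.
have alL : linear (fun m : 'I_n -> M => \sum_(k < n) a k *: m k).
  move=> c u v; rewrite scaler_sumr -big_split; apply: eq_bigr => k _ /=.
  by rewrite -[(c *: u + v) k]/(c *: u k + v k) scalerDr !scalerA mulrC.
have fL : linear (fun m : 'I_n -> M => \sum_(k < n) app (ph k) (m k)).
  move=> c u v; rewrite scaler_sumr -big_split; apply: eq_bigr => k _ /=.
  by rewrite -[(c *: u + v) k]/(c *: u k + v k) linearP.
have app_sum m (r : 'I_m -> R) (h : 'I_m -> hom M E) y :
    app (\sum_(k < m) r k *: h k) y = \sum_(k < m) r k *: app (h k) y.
  by elim/big_rec2: _ => [|k u1 u2 _ <-]; rewrite ?app0 // appD appZ.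
have [m|g gE] := injective_ext (al := lin alL) (f := lin fL) Einj.
  rewrite !linE => am.
  under eq_bigr => k _ do rewrite (phE _ _ (phG k)) app_sum.
  rewrite exchange_big big1 //= => j _.
  under eq_bigr => k _ do rewrite -linearZ.
  rewrite -linear_sum (_ : \sum_(k < n) _ = 0) ?linear0 //.
  apply: (tf _ _ rxe); rewrite scaler_sumr.
  rewrite (eq_bigr (fun k => psi j x *: (a k *: m k))); last first.
    move=> k _; rewrite !scalerA; congr (_ *: _).
    rewrite mulrDl (coordC psiL j (Ia k) Ix) -(coordZ psiL j e (Ia k)) eI // (coord0 psiL) addr0.
    by rewrite mulrC.
  by rewrite -scaler_sumr am scaler0.
exists (to_hom g) => r h Gr; apply: homP => y; rewrite appZ to_homK (phE _ _ Gr) app_sum.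
have := gE (fun k => psi k r *: y); rewrite !linE.
under eq_bigr => k _ do rewrite scalerA mulrC.
rewrite -scaler_suml -aI; last by exists h.
rewrite linearZ /= => ->.
by apply: eq_bigr => k _; rewrite linearZ.
Qed.

(** An element [t] of the kernel of [F (x) A -> F (x) B] is killed by every map
    [g] to the character module: [g] is a map [A -> Hom(F, -)], which extends to
    [B] because that module of maps is injective. *)
Lemma torsion_free_flat (F : lmodType R) :
  noetherian R -> hereditary R -> torsion_free F -> flat_module F.
Proof.
move=> noeth her tf A B i iI FA FB bA bB tA tB h hE.
apply: lin0P => t ht; apply: contrapT => /eqP /charmod_cogenerator[g gt].
have bL : bilinear_for *:%R *:%R (fun x a => g (bA x a)).
  split=> [b|a] c u v; rewrite -linearP /=; congr (g _).
    by rewrite linearDl linearZl_LR.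
  exact: (linearPr bA a c u v).
have [b bE] := bilinear_hom (bilin bL).
have Hinj : injective_module (hom F (charmod R)).
  by apply: hom_torsion_free_injective => //; exact: charmod_injective.
have [b' b'E] := Hinj _ _ i b iI.
have [g' [g'E _]] := tB _ (bilin (hom_bilinear b')).
have [k [_ kU]] := tA _ (bilin bL).
have gk : g t = k t by exact: kU.
have ghk : (g' \o h) t = k t.
  by apply: kU => x a; rewrite /= hE g'E bilinE; have /= -> := b'E a; rewrite bE.
by move: gt; rewrite gk -ghk /= ht linear0 eqxx.
Qed.

Lemma tensor_unit (F : lmodType R) :
  exists b : {bilinear F -> R^o -> F}, is_tensor_product b /\ forall x r, b x r = r *: x.
Proof.
have bL : bilinear_for *:%R *:%R (fun (x : F) (r : R^o) => (r : R) *: x).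
  split=> [r|x] c u v; first by rewrite /= scalerDr !scalerA mulrC.
  by rewrite /= scalerDl scalerA.
exists (bilin bL); split=> // V phi.
have hL : linear (fun x => phi x 1) by move=> c u v; rewrite linearDl linearZl_LR.
exists (lin hL); split=> [x r|h' h'E x].
  rewrite bilinE linE linearZl_LR /= -linearZr_LR /=; congr (phi x _).
  by rewrite -[_ *: _]/(r * 1) mulr1.
by rewrite linE -h'E bilinE scale1r.
Qed.

Lemma flat_torsion_free (F : lmodType R) : flat_module F -> torsion_free F.
Proof.
move=> flat s x rs sx; have [b [bT bE]] := tensor_unit F.
have mI : injective (scale_by (s : R^o)).
  by apply: lin0P => r; rewrite linE -[_ *: _]/(_ * _) mulrC => /rs.
have sL : linear (fun y : F => s *: y).
  by move=> c u v; rewrite scalerDr !scalerA mulrC.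
have /(_ _) hI := flat _ _ _ mI _ _ b b bT bT (lin sL).
apply: hI; last by rewrite !linE sx scaler0.
by move=> y r; rewrite linE !bE scalerA mulrC.
Qed.

End Flat.

(** * Duals of modules are cotorsion *)

Section Duals.
Variable R : comNzRingType.

(** The relations are all the combinations of pairs that every bilinear map
    kills, so that no generating set of relations has to be described. *)
Lemma tensor_product_exists (A B : lmodType R) :
  exists (T : lmodType R) (b : {bilinear A -> B -> T}), is_tensor_product b.
Proof.
pose X : choiceType := (A * B)%type.
pose ext (V : lmodType R) (phi : {bilinear A -> B -> V}) : {linear free R X -> V} :=
  free_map (fun p : X => phi p.1 p.2).
pose rel (z : free R X) := forall (V : lmodType R) (phi : {bilinear A -> B -> V}),
  ext V phi z = 0.
have rel0 : rel 0 by move=> V phi; rewrite linear0.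
have relL a u v : rel u -> rel v -> rel (a *: u + v).
  by move=> Ru Rv V phi; rewrite linearP /= Ru Rv scaler0 addr0.
pose T := quot (Submod rel0 relL).
pose q : {linear free R X -> T} := proj (Submod rel0 relL).
have bL : bilinear_for *:%R *:%R (fun a b => q (fgen R ((a, b) : X))).
  split=> [b|a] c u v; rewrite -linearP /=; apply/proj_eq => V phi.
    rewrite linearB linearP /= /ext !free_map_gen /=.
    by rewrite linearDl linearZl_LR subrr.
  rewrite linearB linearP /= /ext !free_map_gen /=.
  by apply/eqP; rewrite subr_eq0; apply/eqP; exact: (linearPr phi a c u v).
exists T, (bilin bL) => V phi.
have [z /proj_eq0 zr|h hE] := descend (q := q) (f := ext V phi) (@proj_surj _ _ _).
  exact: zr.
exists h; split=> [a b|h' h'E x].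
  by rewrite bilinE hE /ext free_map_gen.
have [z <-] := @proj_surj _ _ _ x.
have e : h' \o q =1 h \o q.
  apply: free_eq => -[a b] /=; have := h'E a b; rewrite bilinE => ->.
  by rewrite hE /ext free_map_gen.
exact: e.
Qed.

(** Maps [A -> Hom(F, E)] are maps [F (x) A -> E], and [F (x) A] embeds in
    [F (x) B]. *)
Lemma hom_flat_injective (F E : lmodType R) :
  flat_module F -> injective_module E -> injective_module (hom F E).
Proof.
move=> flat Einj A B i f iI.
have [TA [bA bAT]] := tensor_product_exists F A.
have [TB [bB bBT]] := tensor_product_exists F B.
have biL : bilinear_for *:%R *:%R (fun x a => bB x (i a)).
  split=> [a|x] c u v /=; first by rewrite linearDl linearZl_LR.
  by rewrite linearP; exact: (linearPr bB x c (i u) (i v)).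
have [h [hE _]] := bAT _ (bilin biL).
have hI : injective h by apply: (flat _ _ i iI _ _ bA bB).
have [t [tE _]] := bAT _ (bilin (hom_bilinear f)).
have [t' t'E] := Einj _ _ h t hI.
have tL : bilinear_for *:%R *:%R (fun x b => t' (bB x b)).
  split=> [b|x] c u v; rewrite -linearP /=; congr (t' _).
    by rewrite linearDl linearZl_LR.
  exact: (linearPr bB x c u v).
have [g gE] := bilinear_hom (bilin tL).
exists g => a /=; apply: homP => x; rewrite gE bilinE.
have := hE x a; rewrite bilinE => <-.
by have /= -> := t'E (bA x a); rewrite tE.
Qed.

Lemma hom_swap (A B C : lmodType R) (f : {linear B -> hom A C}) :
  exists g : {linear A -> hom B C}, forall a b, app (g a) b = app (f b) a.
Proof.
have fL : bilinear_for *:%R *:%R (fun b a => app (f b) a).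
  by split=> [a|b] c u v; rewrite !linearP.
by have [g gE] := bilinear_hom (bilin fL); exists g => a b; rewrite gE.
Qed.

Lemma precomp_linear (A B C : lmodType R) (f : {linear A -> B}) :
  linear (fun h : hom B C => to_hom (app h \o f)).
Proof. by move=> a u v; apply: homP. Qed.
Definition precomp (A B C : lmodType R) (f : {linear A -> B}) :
  {linear hom B C -> hom A C} := lin (@precomp_linear A B C f).

Lemma precompE (A B C : lmodType R) (f : {linear A -> B}) (h : hom B C) x :
  app (precomp C f h) x = app h (f x).
Proof. by []. Qed.

(** [Ext^1(F, Hom(N, E)) = Ext^1(N, Hom(F, E)) = 0], as [Hom(F, E)] is
    injective.  Concretely, a cocycle is first solved over a free cover of [N],
    and the solution is then corrected on the relations of [N], where it comes
    from [Hom(F, E)]. *)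
Lemma dual_cotorsion (N E : lmodType R) : injective_module E -> cotorsion (hom N E).
Proof.
move=> Einj F flat P f fd1.
have /choice[gn gnE] (n : N) : exists g : {linear pr_mod P 0 -> E},
    forall x, g (pr_diff P 0 x) = app (f x) n.
  have fL : linear (fun x => app (f x) n) by move=> a u v; rewrite linearP.
  have [|g gE] := injective_ext (al := pr_diff P 0) (f := lin fL) Einj.
    by move=> x /pr_exactS[y <-]; rewrite linE fd1 app0.
  by exists g => x; rewrite gE linE.
pose eps : {linear free R N -> N} := free_map (fun n : N => n).
pose G0 : {linear free R N -> hom (pr_mod P 0) E} := free_map (fun n => to_hom (gn n)).
have G0E x z : app (G0 z) (pr_diff P 0 x) = app (f x) (eps z).
  have aL : linear (fun z => app (G0 z) (pr_diff P 0 x)) by move=> a u v; rewrite linearP.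
  have := free_eq (f := lin aL) (g := app (f x) \o eps) _ z; apply=> n.
  by rewrite linE /= /G0 /eps !free_map_gen to_homK gnE.
have pI : injective (precomp E (pr_aug P)).
  apply: lin0P => h h0; apply: homP => y; have [x <-] := pr_aug_surj P y.
  by have /(congr1 (fun h => app h x)) := h0; rewrite precompE.
have [|k kE] := factor_inj (f := G0 \o incl (ker eps)) pI.
  move=> z; have [|h hE] := descend (q := pr_aug P) (f := app (G0 (sv z))) (@pr_aug_surj _ _ P).
    by move=> x /pr_exact0[y <-]; rewrite G0E (svP z) linear0.
  by exists (to_hom h); apply: homP => x; rewrite precompE to_homK hE.
have [k' k'E] := hom_flat_injective flat Einj k (@incl_inj _ _ (ker eps)).
have [|H HE] := descend (q := eps) (f := G0 \- (precomp E (pr_aug P) \o k')) (@free_cover _ _).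
  move=> z ez /=; apply/eqP; rewrite subr_eq0; apply/eqP.
  have := kE (Subm (N := ker eps) ez); rewrite /= => <-.
  by congr (precomp _ _ _); have /= <- := k'E (Subm (N := ker eps) ez).
have [g gE] := hom_swap H.
exists g => x; apply: homP => n; have [z <-] := @free_cover _ _ n.
rewrite gE HE appB G0E precompE.
have -> : pr_aug P (pr_diff P 0 x) = 0 by apply/pr_exact0; exists x.
by rewrite linear0 subr0.
Qed.

End Duals.

(** * Inverse limits *)

Lemma dependent_choice (T : Type) (U : T -> Type) (P : forall t, U t -> Prop) :
  (forall t, exists u, P t u) -> exists f : forall t, U t, forall t, P t (f t).
Proof. by move=> ex; exists (fun t => sval (cid (ex t))) => t; case: cid. Qed.

Section Limits.
Variable R : comNzRingType.

Section Tower.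
Variables (I : nat -> lmodType R) (p : forall n, {linear I n.+1 -> I n}).
Variables (L : lmodType R) (pi : forall n, {linear L -> I n}).
Hypothesis lim : is_inverse_limit p pi.

Lemma limit_eq (y z : L) : (forall n, pi n y = pi n z) -> y = z.
Proof.
case: lim => piC ex yz; have [x [_ xU]] := ex (fun n => pi n y) (fun n => piC n y).
by rewrite -(xU y) // -(xU z) // => n; rewrite yz.
Qed.

Lemma limit_lift (X : lmodType R) (g : forall n, {linear X -> I n}) :
  (forall n x, p n (g n.+1 x) = g n x) ->
  exists h : {linear X -> L}, forall n x, pi n (h x) = g n x.
Proof.
move=> gC; case: (lim) => piC ex.
have /choice[h hE] x : exists y, forall n, pi n y = g n x.
  by have [y [yE _]] := ex (fun n => g n x) (fun n => gC n x); exists y.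
have hL : linear h.
  by move=> a u v; apply: limit_eq => n; rewrite hE !linearP /= !hE.
by exists (lin hL) => n x; rewrite linE hE.
Qed.

(** Obstructions to extending a map to the limit lie in the first derived
    limit of the groups [Hom(Y, I n)]. *)
Lemma limit_extend (A B Y : lmodType R) (d : {linear A -> B}) (q : {linear B -> Y})
    (f : {linear A -> L}) :
  (forall n, injective_module (I n)) ->
  (forall a, q (d a) = 0) -> (forall b, q b = 0 -> exists a, d a = b) ->
  (forall a, d a = 0 -> f a = 0) ->
  (forall h : forall n, {linear Y -> I n}, exists k : forall n, {linear Y -> I n},
     forall n y, h n y = k n y - p n (k n.+1 y)) ->
  exists g : {linear B -> L}, forall a, g (d a) = f a.
Proof.
move=> Iinj qd exq df lim1; case: (lim) => piC _.
have gex n : exists g : {linear B -> I n}, forall a, g (d a) = pi n (f a).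
  apply: (injective_ext (f := pi n \o f) (Iinj n)) => a /df /= ->.
  by rewrite linear0.
have [g gE] := dependent_choice gex.
have hex n : exists h : {linear Y -> I n}, forall b, h (q b) = g n b - p n (g n.+1 b).
  apply: (injective_ext (f := g n \- (p n \o g n.+1)) (Iinj n)) => b /exq[a <-] /=.
  by rewrite !gE piC subrr.
have [h hE] := dependent_choice hex.
have [k kE] := lim1 h.
have [|G GE] := limit_lift (g := fun n => g n \- (k n \o q)).
  move=> n b /=; rewrite linearB /=; have := kE n (q b); rewrite hE => e.
  have -> : g n b = p n (g n.+1 b) + (k n (q b) - p n (k n.+1 (q b))) by rewrite -e addrC subrK.
  by rewrite addrA addrAC addrK.
exists G => a; apply: limit_eq => n.
by rewrite GE /= gE qd linear0 subr0.
Qed.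

Hypothesis pS : forall n, surjective (p n).

Lemma lim1_surjective (w : forall n, I n) :
  exists y : forall n, I n, forall n, w n = y n - p n (y n.+1).
Proof.
pose step n (y : I n) : I n.+1 := sval (cid (pS (y - w n))).
pose y := nat_rect (fun n => I n) 0 step.
exists y => n; rewrite /= /step; case: cid => /= z ->.
by rewrite subKr.
Qed.

Lemma lim1_hom_ring (h : forall n, {linear R^o -> I n}) :
  exists k : forall n, {linear R^o -> I n}, forall n y, h n y = k n y - p n (k n.+1 y).
Proof.
have [w wE] := lim1_surjective (fun n => h n 1).
exists (fun n => scale_by (w n)) => n r; rewrite !linE linearZ /= -scalerBr -wE.
by rewrite -linearZ /= -[r *: _]/(r * 1) mulr1.
Qed.

End Tower.

(** An inverse limit of injectives along surjections has injective dimension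
    at most one, and this passes to direct summands. *)
Lemma in_C_extend (M A B : lmodType R) (d : {linear A -> B}) (q : {linear B -> R^o})
    (f : {linear A -> M}) :
  in_C M -> injective d -> (forall a, q (d a) = 0) ->
  (forall b, q b = 0 -> exists a, d a = b) ->
  exists g : {linear B -> M}, forall a, g (d a) = f a.
Proof.
move=> [L [N [[I [p [pi [Iinj pS lim]]]] [iso [iso' isoK isoK']]]]] dI qd exq.
have inL : linear (fun m : M => iso (m, 0)).
  by move=> a u v; rewrite -linearP; congr (iso (_, _)); rewrite /= scaler0 addr0.
have [a da|g gE] := limit_extend (f := lin inL \o f) lim Iinj qd exq _ (lim1_hom_ring pS).
  by rewrite (inj_eq0 dI da) linear0.
have [b|g' g'E] := factor_inj (f := g) (can_inj isoK).
  by exists (iso' (g b)); rewrite isoK'.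
have g1L : linear (fun b => (g' b).1) by move=> a u v; rewrite linearP.
exists (lin g1L) => a; rewrite linE.
suff -> : g' (d a) = (f a, 0) by [].
by apply: (can_inj isoK); rewrite g'E gE.
Qed.

End Limits.

(** * Rings whose cotorsion modules are limits of injectives are hereditary *)

Section CotorsionHereditary.
Variable R : comNzRingType.

(** By induction on the number [k] of coordinates that may be non-zero: the last
    of these coordinates form a finitely generated ideal, and the vectors where
    it vanishes fall under the induction hypothesis. *)
Lemma noetherian_relations (n : nat) (K : submod ('I_n -> R^o)) : noetherian R ->
  exists (m : nat) (r : 'I_m -> 'I_n -> R^o), (forall j, K (r j)) /\
    forall v, K v -> exists c : 'I_m -> R, v = \sum_(j < m) c j *: r j.
Proof.
move=> noeth.
suff step k : (k <= n)%N -> forall K : submod ('I_n -> R^o),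
    (forall v, K v -> forall i : 'I_n, (k <= i)%N -> v i = 0) ->
    exists (m : nat) (r : 'I_m -> 'I_n -> R^o), (forall j, K (r j)) /\
      forall v, K v -> exists c : 'I_m -> R, v = \sum_(j < m) c j *: r j.
  by apply: (step n (leqnn n)) => v _ i; rewrite leqNgt ltn_ord.
elim: k => [_|k IH kn] {}K K0.
  exists 0%N, (fun _ => 0); split=> [[]//|v Kv]; exists (fun _ => 0).
  by rewrite big_ord0; apply/funext => i; exact: K0.
set i0 := Ordinal kn.
have K1_0 : K 0 /\ (0 : 'I_n -> R^o) i0 = 0 by split=> //; exact: submod0.
have K1_L a u v : K u /\ u i0 = 0 -> K v /\ v i0 = 0 ->
    K (a *: u + v) /\ (a *: u + v) i0 = 0.
  move=> [Ku u0] [Kv v0]; split; first exact: submodL.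
  by rewrite -[LHS]/(a *: u i0 + v i0) u0 v0 scaler0 addr0.
have [|m1 [r1 [r1K K1r]]] := IH (ltnW kn) (Submod K1_0 K1_L).
  move=> v [Kv v0] i; rewrite leq_eqVlt => /orP[/eqP ki|]; last exact: K0.
  by have -> : i = i0 by exact: val_inj.
have J0 : exists2 v, K v & v i0 = 0 by exists 0 => //; exact: submod0.
have JL a (x y : R^o) : (exists2 v, K v & v i0 = x) -> (exists2 v, K v & v i0 = y) ->
    exists2 v, K v & v i0 = a *: x + y.
  by move=> [u Ku <-] [v Kv <-]; exists (a *: u + v) => //; exact: submodL.
have [m2 [g [gJ Jg]]] := noetherian_fg (Submod J0 JL) noeth.
have /choice[r2 r2P] j : exists v, K v /\ v i0 = g j by have [v] := gJ j; exists v.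
exists (m1 + m2)%N, (fun j => match fintype.split j with inl j => r1 j | inr j => r2 j end).
split=> [j|v Kv]; first by case: (fintype.split j) => j'; [case: (r1K j')|case: (r2P j')].
have [c2 c2E] : exists c2 : 'I_m2 -> R, v i0 = \sum_(j < m2) c2 j * g j.
  by apply: Jg; exists v.
pose w := v - \sum_(j < m2) c2 j *: r2 j.
have [|c1 c1E] := K1r w.
  split.
    apply: (submodB (N := K)) => //; apply: submod_sum => j _.
    by apply: submodZ; case: (r2P j).
  have sumE : (\sum_(j < m2) c2 j *: r2 j) i0 = v i0.
    rewrite c2E; elim/big_rec2: _ => // j y1 y2 _ <-.
    by rewrite -[LHS]/(c2 j * r2 j i0 + y2 i0); case: (r2P j) => _ ->.
  by rewrite /w -[LHS]/(v i0 - (\sum_(j < m2) c2 j *: r2 j) i0) sumE subrr.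
exists (fun j => match fintype.split j with inl j => c1 j | inr j => c2 j end).
rewrite big_split_ord /= -[v](subrK (\sum_(j < m2) c2 j *: r2 j)) -/w c1E.
congr (_ + _); apply: eq_bigr => j _.
  by rewrite -[lshift _ _]/(unsplit (inl j)) unsplitK.
by rewrite -[rshift _ _]/(unsplit (inr j)) unsplitK.
Qed.

(** [Ext^1(I, M) = 0] for every ideal [I] and every bidual [M].  The module
    [K] of relations between generators of [I] is pure in its bidual, so the
    extension to the free module of [K -> K^**] can be brought back to [K]:
    it amounts to a finite system of linear equations. *)
Lemma cotorsion_in_C_hereditary : noetherian R ->
  (forall M : lmodType R, cotorsion M -> in_C M) -> hereditary R.
Proof.
move=> noeth cotC I; have [n [g [Ig gI]]] := noetherian_fg I noeth.
pose K := ker (comb g); pose E := charmod R.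
have [m [r [rK Kr]]] := noetherian_relations K noeth.
pose rel j k : R := r j k.
pose Kd : lmodType R := hom (subm K) E.
have evL (z : subm K) : linear (fun phi : Kd => app phi z) by [].
have ev_linear : linear (fun z => to_hom (lin (evL z))).
  move=> a u v; apply: homP => phi; rewrite app_linear !to_homK.
  exact: (linearP (app phi) a u v).
have Cbid : in_C (hom Kd E).
  by apply: cotC; apply: dual_cotorsion; exact: charmod_injective.
have [c cE] : exists c : {linear ('I_n -> R^o) -> hom Kd E},
    forall z, c (incl K z) = lin ev_linear z.
  apply: (in_C_extend (q := comb g) (lin ev_linear) Cbid (@incl_inj _ _ K)) => [z|b b0].
    exact: svP z.
  by exists (Subm (N := K) b0).
pose unit_vec k : 'I_n -> R^o := fun i => (i == k)%:R.
have vecE (v : 'I_n -> R^o) : v = \sum_(k < n) v k *: unit_vec k.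
  apply/funext => i; have -> : (\sum_(k < n) v k *: unit_vec k) i = \sum_(k < n) v k * (i == k)%:R.
    by elim/big_rec2: _ => // k y1 y2 _ <-.
  rewrite (bigD1 i) //= eqxx mulr1 big1 ?addr0 // => k /negbTE ki.
  by rewrite eq_sym ki mulr0.
pose d : 'I_m -> subm K := fun j => Subm (rK j).
have TL : linear (fun x : 'I_n -> subm K => (fun j => \sum_(k < n) rel j k *: x k) : 'I_m -> subm K).
  move=> a u v; apply/funext => j.
  rewrite -[RHS]/(a *: (\sum_(k < n) rel j k *: u k) + \sum_(k < n) rel j k *: v k).
  rewrite scaler_sumr -big_split; apply: eq_bigr => k _ /=.
  by rewrite -[(a *: u + v) k]/(a *: u k + v k) scalerDr !scalerA mulrC.
have [x xE] : exists x, lin TL x = d.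
  apply: contrapT => nd; have dn0 : proj (img (lin TL)) d != 0.
    by apply/eqP => /proj_eq0.
  have [chi chid] := charmod_cogenerator dn0.
  pose at_ (N : nat) j (z : subm K) : 'I_N -> subm K := fun i => if i == j then z else 0.
  have atL N j : linear (at_ N j).
    move=> a u v; apply/funext => i; rewrite -[RHS]/(a *: at_ N j u i + at_ N j v i) /at_.
    by case: eqP => // _; rewrite scaler0 addr0.
  have atE N (y : 'I_N -> subm K) : y = \sum_(j < N) at_ N j (y j).
    apply/funext => i; have -> : (\sum_(j < N) at_ N j (y j)) i = \sum_(j < N) at_ N j (y j) i.
      by elim/big_rec2: _ => // k y1 y2 _ <-.
    rewrite (bigD1 i) //= {1}/at_ eqxx big1 ?addr0 // => k ki.
    by rewrite /at_ eq_sym (negbTE ki).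
  pose q := proj (img (lin TL)).
  (* The components of [chi] satisfy the relations dual to the equations, and
     the solution [c] in the bidual turns this into [chi (d) = 0]. *)
  pose phi j : Kd := to_hom (chi \o (q \o lin (atL m j))).
  have phiE (y : 'I_m -> subm K) : chi (q y) = \sum_(j < m) app (phi j) (y j).
    by rewrite {1}[y]atE !linear_sum; apply: eq_bigr => j _.
  have phi_rel k : \sum_(j < m) rel j k *: phi j = 0.
    apply: homP => z; rewrite app0.
    have -> : app (\sum_(j < m) rel j k *: phi j) z = \sum_(j < m) rel j k *: app (phi j) z.
      by elim/big_rec2: _ => [|j y1 y2 _ <-]; rewrite ?app0 // appD appZ.
    under eq_bigr => j _ do rewrite -linearZ.
    rewrite -(phiE (fun j => rel j k *: z)).
    suff -> : (fun j => rel j k *: z) = lin TL (at_ n k z).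
      by have /proj_eq0 -> : img (lin TL) (lin TL (at_ n k z)) by [exists (at_ n k z)];
        rewrite linear0.
    rewrite linE; apply/funext => j; rewrite (bigD1 k) //=.
    have -> : at_ n k z k = z by rewrite /at_ eqxx.
    rewrite big1 ?addr0 // => i ik.
    by rewrite /at_ (negbTE ik) scaler0.
  case/negP: chid; rewrite -/q phiE.
  have evE j : app (phi j) (d j) = \sum_(k < n) rel j k *: app (c (unit_vec k)) (phi j).
    have : app (c (r j)) (phi j) = app (phi j) (d j).
      have -> : c (r j) = lin ev_linear (d j) by exact: (cE (d j)).
      by [].
    move=> <-; rewrite {1}[r j]vecE linear_sum.
    by elim/big_rec2: _ => [|k y1 y2 _ <-]; rewrite ?app0 // appD linearZ appZ.
  under eq_bigr => j _ do rewrite evE.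
  rewrite exchange_big big1 //= => k _.
  under eq_bigr => j _ do rewrite -linearZ.
  by rewrite -linear_sum phi_rel linear0.
have rhoL : linear (fun v : 'I_n -> R^o => \sum_(k < n) (v k : R) *: x k).
  move=> a u v; rewrite scaler_sumr -big_split; apply: eq_bigr => k _ /=.
  by rewrite -[(a *: u + v) k]/(a * u k + v k) scalerDl scalerA.
apply: (retraction_dual_basis (rho := lin rhoL) Ig gI) => z.
have [b bE] := Kr _ (svP z).
have -> : z = \sum_(j < m) b j *: d j.
  apply: sv_inj; rewrite bE.
  by elim/big_rec2: _ => // j y1 y2 _ ->.
have rd j : lin rhoL (sv (d j)) = d j by rewrite linE -[in RHS]xE.
have -> : sv (\sum_(j < m) b j *: d j) = \sum_(j < m) b j *: sv (d j).
  by elim/big_rec2: _ => // j y1 y2 _ <-.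
by rewrite linear_sum; apply: eq_bigr => j _; rewrite linearZ /= rd.
Qed.

End CotorsionHereditary.

(** * Cotorsion modules as limits of injectives *)

Section CotorsionLimits.
Variable R : comNzRingType.

(** The saturation condition says that the quotient of [B] by [A] is
    torsion-free, so it is flat, and extensions of it by [C] split. *)
Lemma cotorsion_extend (A B C : lmodType R) (i : {linear A -> B}) (f : {linear A -> C}) :
  noetherian R -> hereditary R -> gldim_le R 1 -> cotorsion C -> injective i ->
  (forall s b, regular s -> (exists a, i a = s *: b) -> exists a, i a = b) ->
  exists h : {linear B -> C}, forall a, h (i a) = f a.
Proof.
move=> noeth her gl Cc iI sat; have [P _] := gl (quot (img i)).
have tf : torsion_free (quot (img i)).
  move=> s x rs; have [b <-] := @proj_surj _ _ (img i) x.
  rewrite -linearZ /= => /proj_eq0 sb; apply/proj_eq0; exact: sat sb.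
have qE b : proj (img i) b = 0 <-> exists a, i a = b by exact: proj_eq0.
have flat := torsion_free_flat noeth her tf.
exact: (resolution_extend (P := P) f iI (@proj_surj _ _ _) qE (Cc _ flat P)).
Qed.

Section DenseQuotient.
Variables (F C : lmodType R) (phi : {linear (nat -> F) -> C}).
Hypothesis phiS : surjective phi.
Hypothesis phi_fin : forall (g : nat -> F) n, (forall i, (n <= i)%N -> g i = 0) -> phi g = 0.

Definition tail n (g : nat -> F) : nat -> F := fun i => if (n <= i)%N then g i else 0.

Lemma tail_linear n : linear (tail n).
Proof.
move=> a u v; apply/funext => i; rewrite -[RHS]/(a *: tail n u i + tail n v i) /tail.
by case: ifP => // _; rewrite scaler0 addr0.
Qed.

Lemma phi_head n g : phi (g - tail n g) = 0.
Proof.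
apply: (phi_fin (n := n)) => i ni; rewrite -[LHS]/(g i - tail n g i) /tail ni.
by rewrite subrr.
Qed.

Section Tower.
Variables (D : lmodType R) (j : {linear (nat -> F) -> D}).
Hypothesis j_inj : forall g, phi g = 0 -> j g = 0 -> g = 0.

Definition step_mem n (e : D) :=
  exists v : nat -> F, [/\ phi v = 0, forall i, (i < n)%N -> v i = 0 & j v = e].

Fact step0 n : step_mem n 0.
Proof. by exists 0; split; rewrite ?linear0. Qed.
Fact stepL n a x y : step_mem n x -> step_mem n y -> step_mem n (a *: x + y).
Proof.
move=> [u [pu u0 <-]] [v [pv v0 <-]]; exists (a *: u + v); split; rewrite ?linearP //=.
  by rewrite pu pv scaler0 addr0.
by move=> i ni; rewrite -[LHS]/(a *: u i + v i) u0 // v0 // scaler0 addr0.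
Qed.
Definition step n : submod D := Submod (step0 n) (@stepL n).

Definition stage n : lmodType R := quot (step n).

Lemma stage_map n : exists p : {linear stage n.+1 -> stage n},
  forall d, p (proj (step n.+1) d) = proj (step n) d.
Proof.
apply: (descend (@proj_surj _ _ (step n.+1))) => d /proj_eq0[v [pv v0 vd]].
by apply/proj_eq0; exists v; split=> // i ni; apply: v0; rewrite ltnS ltnW.
Qed.

Lemma stage_proj n : exists pi : {linear (D * C)%type -> stage n},
  forall d g, pi (d, phi g) = proj (step n) (d - j (tail n g)).
Proof.
have qL : linear (fun x : D * (nat -> F) => (x.1, phi x.2)).
  by move=> a u v; rewrite !linearP.
have fL : linear (fun x : D * (nat -> F) => proj (step n) (x.1 - j (tail n x.2))).
  move=> a u v; rewrite -linearP /=; congr (proj _ _).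
  by rewrite tail_linear linearP /= opprD addrACA scalerBr.
have [||pi piE] := descend (q := lin qL) (f := lin fL).
- by move=> [d c]; have [g <-] := phiS c; exists (d, g).
- move=> [d g]; rewrite !linE /= => -[-> pg]; apply/proj_eq0; rewrite sub0r.
  apply: submodN; exists (tail n g); split=> //.
    by have := phi_head n g; rewrite linearB /= pg sub0r => /eqP; rewrite oppr_eq0 => /eqP.
  by move=> i; rewrite /tail ltnNge => /negbTE ->.
- by exists pi => d g; exact: (piE (d, g)).
Qed.

(** The kernel [V] of [phi] is dense in the complete module [nat -> F], so that
    [C] is the first derived limit of the tails [V_n] of [V].  The limit of the
    quotients [D / V_n] is an extension of [C] by [D], and the extension [j] of
    the inclusion of [V] splits it. *)
Lemma dense_quotient_limit :
  exists (p : forall n, {linear stage n.+1 -> stage n})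
    (pi : forall n, {linear (D * C)%type -> stage n}),
    (forall n, surjective (p n)) /\ is_inverse_limit p pi.
Proof.
have [p pE] := dependent_choice stage_map.
have [pi piE] := dependent_choice stage_proj.
exists p, pi; split=> [n x|].
  by have [d <-] := @proj_surj _ _ _ x; exists (proj (step n.+1) d).
split=> [n [d c]|x xC].
  have [g <-] := phiS c; rewrite !piE pE; apply/proj_eq.
  exists (tail n g - tail n.+1 g); split.
  - apply: (phi_fin (n := n.+1)) => i ni.
    by rewrite -[LHS]/(tail n g i - tail n.+1 g i) /tail ni ltnW // subrr.
  - move=> i ni; rewrite -[LHS]/(tail n g i - tail n.+1 g i) /tail.
    by rewrite leqNgt ni /= ltnNge ltnW // subrr.
  - by rewrite linearB /= opprB [RHS]addrC addrA subrK.
have /dependent_choice[d dE] n : exists d, proj (step n) d = x n.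
  by have [d dE] := @proj_surj _ _ _ (x n); exists d.
have /dependent_choice[v vE] n : exists v : nat -> F,
    [/\ phi v = 0, forall i, (i < n)%N -> v i = 0 & j v = d n - d n.+1].
  by apply/(proj_eq (step n)); rewrite dE -pE dE xC.
pose s n : nat -> F := \sum_(m < n) v m.
have sE n i : s n i = \sum_(m < n) v m i.
  by rewrite /s; elim/big_rec2: _ => // m y1 y2 _ <-.
have ds n : d 0%N - d n = j (s n).
  rewrite /s; elim: n => [|n IH]; first by rewrite big_ord0 linear0 subrr.
  by rewrite big_ord_recr linearD /= -IH; case: (vE n) => _ _ ->; rewrite addrA subrK.
(* The limit of the partial sums [s n]: the terms [v m] with [m > i] vanish at [i]. *)
pose g : nat -> F := fun i => s i.+1 i.
have gs n i : (i < n)%N -> s n i = g i.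
  move=> ni; rewrite /g !sE -(subnKC ni); elim: (n - i.+1)%N => [|k IH]; first by rewrite addn0.
  rewrite addnS big_ord_recr /= IH; case: (vE (i.+1 + k)%N) => _ -> //; first by rewrite addr0.
  by rewrite addSn ltnS leq_addr.
have tailN n h : tail n (- h) = - tail n h.
  by apply/funext => i; rewrite -[RHS]/(- tail n h i) /tail; case: ifP => // _; rewrite oppr0.
have yE n : pi n (d 0%N - j g, phi (- g)) = x n.
  rewrite piE -dE; apply/proj_eq; exists (s n - (g - tail n g)); split.
  - rewrite linearB /= phi_head subr0 /s linear_sum big1 // => m _.
    by case: (vE m).
  - move=> i ni; rewrite -[LHS]/(s n i - (g i - tail n g i)) gs // /tail leqNgt ni /=.
    by rewrite subr0 subrr.
  - rewrite !(linearB j) /= -ds tailN (linearN j) /= opprK opprB addrA addrAC [RHS]addrAC; congr (_ + _).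
    by rewrite addrAC.
exists (d 0%N - j g, phi (- g)); split=> // -[d' c'] y'E.
have [g' g'E] := phiS c'; subst c'.
pose G := g' + g; pose e := d' - (d 0%N - j g).
have /dependent_choice[u uE] n : exists u : nat -> F,
    [/\ phi u = 0, forall i, (i < n)%N -> u i = 0 & j u = e - j (tail n G)].
  have := y'E n; rewrite -(yE n) !piE => /proj_eq.
  have -> // : d' - j (tail n g') - (d 0%N - j g - j (tail n (- g))) = e - j (tail n G).
  have -> : tail n G = tail n g' + tail n g.
    by apply/funext => i; rewrite -[RHS]/(tail n g' i + tail n g i) /tail; case: ifP => // _; rewrite addr0.
  by rewrite tailN (linearD j) (linearN j) /= /e !opprD !opprK addrACA.
have tail0 : tail 0 G = G by [].
have Gu i : G i = - u 0%N i.
  have w0 : G - tail i.+1 G + u 0%N - u i.+1 = 0.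
    apply: j_inj.
      rewrite (linearB phi) (linearD phi) /= phi_head.
      by case: (uE 0%N) => -> _ _; case: (uE i.+1) => -> _ _; rewrite addr0 subr0.
    rewrite (linearB j) (linearD j) (linearB j) /=.
    case: (uE 0%N) => _ _ ->; case: (uE i.+1) => _ _ ->.
    rewrite tail0 opprB -[j G - _ + _]addrC addrA -[_ + _ + j (tail _ _)]addrA subrK.
    by rewrite subrK subrr.
  have := congr1 (fun h => h i) w0.
  rewrite -[LHS]/(G i - tail i.+1 G i + u 0%N i - u i.+1 i) -[RHS]/(0 : F).
  case: (uE i.+1) => _ -> // _; rewrite /tail ltnn !subr0 => /eqP.
  by rewrite addr_eq0 => /eqP.
have GE : G = - u 0%N by apply/funext.
case: (uE 0%N) => pu _ ju; have pG : phi G = 0 by rewrite GE (linearN phi) /= pu oppr0.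
congr (_, _).
  apply/esym/subr0_eq; rewrite -/e; have := ju; rewrite tail0 GE (linearN j) /= opprK.
  by move/eqP; rewrite -subr_eq subrr => /eqP.
apply/esym/eqP; rewrite -subr_eq0 -linearB /= opprK; apply/eqP.
exact: pG.
Qed.

End Tower.

(** In [dense_quotient_limit], take for [D] an injective module containing the
    kernel of [phi]: its quotients are injective too. *)
Lemma dense_quotient_in_L : quotients_injective R ->
  exists D : lmodType R, injective_module D /\ in_L (D * C)%type.
Proof.
move=> qi; have [D [j0 [Dinj j0I]]] := enough_injectives (subm (ker phi)).
have [j jE] := Dinj _ _ (incl (ker phi)) j0 (@incl_inj _ _ _).
have jI g : phi g = 0 -> j g = 0 -> g = 0.
  move=> pg jg; have := jE (Subm (N := ker phi) pg); rewrite /= jg => /esym j0g.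
  by have /(congr1 (@sv _ _ _)) := inj_eq0 j0I j0g.
have [p [pi [pS lim]]] := dense_quotient_limit jI.
exists D; split=> //; exists (stage j), p, pi; split=> // n.
exact: (qi _ _ (proj (step j n)) Dinj (@proj_surj _ _ _)).
Qed.

End DenseQuotient.

Lemma free_torsion_free (X : choiceType) : torsion_free (free R X).
Proof.
move=> s f rs sf; apply: dsumP => x; apply: rs.
by have /(congr1 (fun h => sv h x)) := sf.
Qed.

(** Over a free cover [F] of [C], the map taking an eventually constant sequence
    in [F] to the class in [C] of its eventual value extends to all sequences,
    as the quotient is torsion-free, hence flat. *)
Lemma cotorsion_in_L (C : lmodType R) : noetherian R -> gldim_le R 1 -> cotorsion C ->
  exists D : lmodType R, injective_module D /\ in_L (D * C)%type.
Proof.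
move=> noeth gl Cc.
have qi := gldim1_quotients_injective gl.
have her := quotients_injective_hereditary noeth qi.
pose F : lmodType R := free R C; pose eps : {linear F -> C} := free_map (fun c : C => c).
have tfF : torsion_free F := @free_torsion_free _.
pose eventually (g : nat -> F) c := exists n, forall i, (n <= i)%N -> g i = c.
have ev0 : exists c, eventually 0 c by exists 0, 0%N.
have evP a u v c d : eventually u c -> eventually v d -> eventually (a *: u + v) (a *: c + d).
  move=> [m um] [n vn]; exists (maxn m n) => i; rewrite geq_max => /andP[mi ni].
  by rewrite -[LHS]/(a *: u i + v i) um // vn.
have evL a u v : (exists c, eventually u c) -> (exists c, eventually v c) ->
    exists c, eventually (a *: u + v) c.
  by move=> [c uc] [d vd]; exists (a *: c + d); exact: evP.
have evU g c d : eventually g c -> eventually g d -> c = d.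
  move=> [m gm] [n gn]; rewrite -(gm (maxn m n)) ?leq_maxl // gn //; exact: leq_maxr.
pose H := Submod ev0 evL.
have /choice[value valueE] (z : subm H) : exists c, eventually (sv z) c by exact: svP z.
have valueL : linear (eps \o value).
  move=> a u v /=; rewrite -linearP /=; congr (eps _).
  by apply: (evU _ _ _ (valueE _)); exact: evP.
have [|phi phiE] := cotorsion_extend (lin valueL) noeth her gl Cc (@incl_inj _ _ H).
  move=> s b rs [a ab]; suff Hb : H b by exists (Subm Hb).
  have [c [n an]] := svP a; exists (b n), n => i ni; apply/subr0_eq/(tfF _ _ rs).
  have ai k : sv a k = s *: b k by have /(congr1 (fun h => h k)) := ab.
  by rewrite scalerBr -!ai !an // subrr.
have phi_ev g c : eventually g c -> phi g = eps c.
  move=> gc; have Hg : H g by exists c.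
  have := phiE (Subm Hg); rewrite linE /= => ->; congr (eps _).
  exact: evU (valueE (Subm Hg)) gc.
apply: (dense_quotient_in_L (phi := phi)) => //.
- move=> c; have [z <-] := @free_cover _ C c.
  by exists (fun _ => z); apply: phi_ev; exists 0%N.
- by move=> g n gn; rewrite (phi_ev g 0) ?linear0 //; exists n.
Qed.

End CotorsionLimits.

(** * Prime ideals in noetherian rings *)

Section Primes.
Variable R : comNzRingType.

(** Zorn's lemma gives a maximal bad ideal: the union of a chain of bad ideals is
    finitely generated, so it is already a member of the chain. *)
Lemma noetherian_ind (good : submod R^o -> Prop) : noetherian R ->
  (forall I : submod R^o, (forall J : submod R^o, (forall x, I x -> J x) ->
      (exists x, J x /\ ~ I x) -> good J) -> good I) ->
  forall I, good I.
Proof.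
move=> noeth step I0; apply: contrapT => bad0.
pose bad (X : set R) := exists I : submod R^o, (forall x, I x <-> X x) /\ ~ good I.
have [F FP totF|X [PX maxX]] := @Zorn_bigcup _ (fun X => X = set0 \/ bad X).
  have [[X0 FX0 [p X0p]]|nX] := pselect (exists2 X, F X & exists p, X p); last first.
    left; apply/seteqP; split=> // p [X FX Xp]; apply: nX.
    by exists X => //; exists p.
  have badF Y q : F Y -> Y q -> bad Y.
    by move=> FY Yq; case: (FP Y FY) => // Y0; rewrite Y0 in Yq.
  pose U : set R := \bigcup_(X in F) X.
  have U0 : U 0.
    by exists X0 => //; have [I [IX _]] := badF _ _ FX0 X0p; apply/IX; exact: submod0.
  have UL a (u v : R^o) : U u -> U v -> U (a *: u + v).
    move=> [Y FY Yu] [Z FZ Zv]; case: (totF _ _ FY FZ) => YZ.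
      exists Z => //; have [I [IZ _]] := badF _ _ FZ Zv; apply/IZ.
      by apply: submodL; apply/IZ => //; exact: YZ.
    exists Y => //; have [I [IY _]] := badF _ _ FY Yu; apply/IY.
    by apply: submodL; apply/IY => //; exact: YZ.
  have [n [g [Ug gU]]] := noetherian_fg (Submod U0 UL) noeth.
  have [Y FY [Y0 Yg]] : exists2 Y, F Y & Y 0 /\ forall k, Y (g k).
    suff upto m : exists2 Y, F Y & Y 0 /\ forall k : 'I_n, (k < m)%N -> Y (g k).
      by have [Y FY [Y0 Yg]] := upto n; exists Y => //; split=> // k; exact: Yg.
    elim: m => [|m [Y FY [Y0 Yg]]].
      exists X0 => //; split=> //.
      by have [I [IX _]] := badF _ _ FX0 X0p; apply/IX; exact: submod0.
    have [mn|nm] := ltnP m n; last first.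
      by exists Y => //; split=> // k _; apply: Yg; exact: leq_trans (ltn_ord k) nm.
    have [Z FZ Zg] := Ug (Ordinal mn).
    have kE (k : 'I_n) : (k < m.+1)%N -> k = Ordinal mn \/ (k < m)%N.
      rewrite ltnS leq_eqVlt => /orP[/eqP km|]; last by right.
      by left; exact: val_inj.
    case: (totF _ _ FY FZ) => YZ.
      exists Z => //; split=> [|k /kE[->|/Yg]//]; exact: YZ.
    by exists Y => //; split=> // k /kE[->|/Yg//]; exact: YZ.
  right; have [I [IY nI]] := badF _ _ FY Y0; exists I; split=> // x; split.
    by move/IY => Yx; exists Y.
  move=> /gU[c ->]; apply: submod_sum => k _.
  by apply: (submodZ (N := I)); apply/IY.
have badI0 : bad [set x | I0 x] by exists I0.
case: PX => [X0|[I [IX nI]]].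
  apply: (maxX [set x | I0 x]); last by right.
  by rewrite X0; split=> // /(_ 0); apply; exact: (submod0 I0).
apply: nI; apply: step => J IJ [x [Jx nIx]]; apply: contrapT => nJ.
apply: (maxX [set x | J x]); last by right; exists J.
split; first by move=> y /IX/IJ.
by move=> JX; apply: nIx; apply/IX; exact: JX.
Qed.

Section PrimeIdeal.
Variable P : set R.
Hypothesis Pp : is_prime_ideal P.

Lemma prime0 : P 0. Proof. by case: Pp => -[+ _ _] _; rewrite inE. Qed.
Lemma prime1 : ~ P 1.
Proof. by case: Pp => -[_ /negP P1 _] _ P1'; apply: P1; rewrite inE. Qed.
Lemma primeL (a : R) (u v : R^o) : P u -> P v -> P (a *: u + v).
Proof.
case: Pp => -[_ _ PL] _ Pu Pv.
by have := PL a u v; rewrite !inE; apply.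
Qed.
Lemma primeM (x y : R) : P (x * y) -> P x \/ P y.
Proof.
case: Pp => _ PM; have := PM x y; rewrite !inE => + Pxy.
by move=> /(_ Pxy)/orP[]; rewrite inE; [left|right].
Qed.

Definition prime_submod : submod R^o := Submod prime0 primeL.

Lemma primeMl (x y : R) : P y -> P (x * y).
Proof. exact: (submodZ (N := prime_submod)). Qed.
Lemma primeMr (x y : R) : P x -> P (x * y).
Proof. by rewrite mulrC; exact: primeMl. Qed.
Lemma primeD (x y : R) : P x -> P y -> P (x + y).
Proof. exact: (submodD (N := prime_submod)). Qed.
Lemma primeB (x y : R) : P x -> P y -> P (x - y).
Proof. exact: (submodB (N := prime_submod)). Qed.
End PrimeIdeal.

Lemma primeP (P : set R) : P 0 -> ~ P 1 ->
  (forall (a u v : R), P u -> P v -> P (a * u + v)) ->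
  (forall x y, P (x * y) -> P x \/ P y) -> is_prime_ideal P.
Proof.
move=> P0 P1 PL PM; split; first split.
- by rewrite inE.
- by apply/negP; rewrite inE.
- by move=> a u v; rewrite !inE; exact: PL.
- by move=> u v; rewrite !inE => /PM[Px|Py]; apply/orP; [left|right]; rewrite inE.
Qed.

Section AddPrincipal.
Variables (I : submod R^o) (x : R).
Fact addp0 : exists (r : R) y, I y /\ (0 : R^o) = y + r * x.
Proof. by exists 0, 0; rewrite mul0r addr0; split=> //; exact: submod0. Qed.
Fact addpL a (u v : R^o) : (exists (r : R) y, I y /\ u = y + r * x) ->
  (exists (r : R) y, I y /\ v = y + r * x) ->
  exists (r : R) y, I y /\ a *: u + v = y + r * x.
Proof.
move=> [r [y [Iy ->]]] [s [z [Iz ->]]]; exists (a * r + s), (a *: y + z).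
split; first exact: submodL.
by rewrite mulrDl scalerDr -mulrA addrACA.
Qed.
Definition add_principal : submod R^o := Submod addp0 addpL.

Lemma add_principal_l y : I y -> add_principal y.
Proof. by move=> Iy; exists 0, y; rewrite mul0r addr0. Qed.
Lemma add_principal_r : add_principal x.
Proof. by exists 1, 0; rewrite mul1r add0r; split=> //; exact: submod0. Qed.
End AddPrincipal.

(** Noetherian induction: if [a b] is in [I], products for [I + (a)] and
    [I + (b)] multiply to one for [I]. *)
Lemma prime_product (I : submod R^o) : noetherian R ->
  exists s : seq (set R), (forall P, P \in s -> is_prime_ideal P /\ forall x, I x -> P x) /\
    forall c : set R -> R, (forall P, P \in s -> P (c P)) -> I (\prod_(P <- s) c P).
Proof.
move=> noeth; elim/(noetherian_ind): I => //= I IH.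
have [I1|nI1] := pselect (I 1); first by exists [::]; split=> // c _; rewrite big_nil.
have [[a [b [Iab nIa nIb]]]|prI] := pselect (exists a b : R, [/\ I (a * b), ~ I a & ~ I b]).
  have [||s [sP sI]] := IH (add_principal I a).
  - exact: add_principal_l.
  - by exists a; split=> //; exact: add_principal_r.
  have [||t [tP tI]] := IH (add_principal I b).
  - exact: add_principal_l.
  - by exists b; split=> //; exact: add_principal_r.
  exists (s ++ t); split=> [P|c cP].
    rewrite mem_cat => /orP[/sP|/tP] [Pp IP]; split=> // x Ix; apply: IP; exact: add_principal_l.
  rewrite big_cat /=.
  have [|r [y [Iy ->]]] := sI c; first by move=> P Ps; apply: cP; rewrite mem_cat Ps.
  have [|r' [y' [Iy' ->]]] := tI c; first by move=> P Ps; apply: cP; rewrite mem_cat Ps orbT.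
  have -> : (y + r * a) * (y' + r' * b) = (y' + r' * b) * y + (r * a * y' + r * r' * (a * b)).
    by ring.
  by apply: (submodL (s := I)) => //; apply: (submodL (s := I)) => //; apply: (submodZ (N := I)).
exists [:: [set x | I x]]; split=> [P|c cP].
  rewrite inE => /eqP ->; split=> //; apply: primeP => //.
  - exact: (submod0 I).
  - by move=> a u v; exact: (submodL (s := I)).
  - move=> x y Ixy; apply: contrapT => /not_orP[nx ny]; apply: prI.
    by exists x, y.
by rewrite big_seq1; apply: cP; rewrite inE.
Qed.

End Primes.

(** * Limits of injectives are cotorsion when the spectrum is countable *)

Section Sequences.
Variables (R : comNzRingType) (s : nat -> R).

Definition sprod j k : R := \prod_(i < k) s (j + i).

Lemma sprod0 j : sprod j 0 = 1. Proof. exact: big_ord0. Qed.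
Lemma sprodS j k : sprod j k.+1 = s j * sprod j.+1 k.
Proof.
rewrite /sprod big_ord_recl addn0; congr (_ * _).
by apply: eq_bigr => i _; rewrite addSnnS.
Qed.
Lemma sprodSr j k : sprod j k.+1 = sprod j k * s (j + k).
Proof. by rewrite /sprod big_ord_recr. Qed.
Lemma sprodD j k l : sprod j (k + l) = sprod j k * sprod (j + k) l.
Proof.
elim: k j => [|k IH] j; first by rewrite addn0 sprod0 mul1r.
by rewrite addSn !sprodS IH -addSnnS mulrA.
Qed.

Section DivSeq.
Variable W : lmodType R.

Fact dseq0 j : s j *: (0 : nat -> W) j.+1 = (0 : nat -> W) j.
Proof. exact: scaler0. Qed.
Fact dseqL a (x y : nat -> W) : (forall j, s j *: x j.+1 = x j) ->
  (forall j, s j *: y j.+1 = y j) -> forall j, s j *: (a *: x + y) j.+1 = (a *: x + y) j.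
Proof.
move=> xs ys j; rewrite -![(a *: x + y) _]/(a *: x _ + y _) scalerDr ys -(xs j).
by rewrite !scalerA mulrC.
Qed.

(** These sequences are the linear maps from the localization
    [R[1/s_0, 1/s_1, ...]] to [W], given by their values at the
    [1 / (s_0 ... s_(j-1))]. *)
Definition dseq : lmodType R :=
  subm (Submod (smem := fun x : nat -> W => forall j, s j *: x j.+1 = x j) dseq0 dseqL).

Definition dval (x : dseq) : nat -> W := sv x.

Lemma dvalS (x : dseq) j : s j *: dval x j.+1 = dval x j. Proof. exact: svP x j. Qed.
Lemma dvalZ a (x : dseq) j : dval (a *: x) j = a *: dval x j. Proof. by []. Qed.
Lemma dseqP (x y : dseq) : (forall j, dval x j = dval y j) -> x = y.
Proof. by move=> xy; apply: sv_inj; apply/funext. Qed.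

Definition to_dseq (x : nat -> W) (xs : forall j, s j *: x j.+1 = x j) : dseq :=
  Subm (N := Submod (smem := fun x : nat -> W => forall j, s j *: x j.+1 = x j) dseq0 dseqL) xs.

Lemma to_dseqE x xs j : dval (@to_dseq x xs) j = x j. Proof. by []. Qed.

Lemma sprod_dval x j k : sprod j k *: dval x (j + k) = dval x j.
Proof.
elim: k => [|k IH]; first by rewrite sprod0 scale1r addn0.
by rewrite sprodSr -scalerA addnS dvalS.
Qed.

(** For regular [s_j], this makes [R[1/s_0, 1/s_1, ...]] the total ring of
    fractions of [R]. *)
Definition exhausting := forall r, regular r -> forall j, exists k q, sprod j k = q * r.

Hypothesis sE : exhausting.

Lemma dseq_torsion_free : torsion_free dseq.
Proof.
move=> r x rr rx; apply: dseqP => j; have [k [q kq]] := sE rr j.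
rewrite -(sprod_dval x j k) kq -scalerA -dvalZ rx.
exact: scaler0.
Qed.

(** Dividing [x] by [r] gives [q x_(j+k)] in position [j] when
    [s_j ... s_(j+k-1) = q r].  As [r] is regular, this depends neither on [k]
    nor on [q], which makes these elements compatible. *)
Lemma dseq_divisible : divisible dseq.
Proof.
move=> r x rr.
have quo j k l a b : sprod j k = a * r -> sprod j l = b * r -> a *: dval x (j + k) = b *: dval x (j + l).
  wlog kl : k l a b / (k <= l)%N => [wl ka lb|ka].
    by case/orP: (leq_total k l) => ?; [exact: wl | apply/esym; exact: wl].
  rewrite -(subnKC kl) sprodD ka => lb; rewrite -(sprod_dval x (j + k) (l - k)) scalerA addnA.
  congr (_ *: _); apply/subr0_eq/rr; rewrite mulrBr ![r * _]mulrC -lb.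
  by rewrite mulrAC subrr.
have /choice[y yE] j : exists y, exists k q, sprod j k = q * r /\ y = q *: dval x (j + k).
  by have [k [q kq]] := sE rr j; exists (q *: dval x (j + k)), k, q.
have ys j : s j *: y j.+1 = y j.
  have [k [q [kq ->]]] := yE j; have [l [t [lt ->]]] := yE j.+1.
  rewrite scalerA addSnnS; apply/esym; apply: quo => //.
  by rewrite sprodS lt mulrA.
exists (to_dseq ys); apply: dseqP => j; rewrite dvalZ to_dseqE.
have [k [q [kq ->]]] := yE j; by rewrite scalerA mulrC -kq sprod_dval.
Qed.

End DivSeq.

Lemma dmap_linear (V W : lmodType R) (f : {linear V -> W}) (x : dseq V) j :
  s j *: f (dval x j.+1) = f (dval x j).
Proof. by rewrite -linearZ dvalS. Qed.

Fact dmapL (V W : lmodType R) (f : {linear V -> W}) :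
  linear (fun x : dseq V => to_dseq (dmap_linear f x)).
Proof. by move=> a x y; apply: dseqP => j; exact: (linearP f a (dval x j) (dval y j)). Qed.
Definition dmap (V W : lmodType R) (f : {linear V -> W}) : {linear dseq V -> dseq W} :=
  lin (dmapL f).
Lemma dmapE (V W : lmodType R) (f : {linear V -> W}) x j : dval (dmap f x) j = f (dval x j).
Proof. by []. Qed.

End Sequences.

(** If the spectrum is countable, choose a regular element in each prime ideal
    that contains one.  A regular [r] divides a product of the chosen elements,
    since [(r)] contains a product of primes containing [r]. *)
Lemma exhausting_sequence (R : comNzRingType) : noetherian R -> countable (Spec R) ->
  exists s : nat -> R, (forall j, regular (s j)) /\ exhausting s.
Proof.
move=> noeth /countable_injP[f finj].
have /choice[c cP] (P : set R) : exists x, regular x /\ ((exists2 y, P y & regular y) -> P x).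
  have [[y Py ry]|nP] := pselect (exists2 y, P y & regular y); first by exists y.
  by exists 1; split=> //; exact: regular1.
have /choice[t tP] n : exists x, regular x /\ forall P, is_prime_ideal P -> f P = n -> x = c P.
  have [[P [Pp fP]]|nP] := pselect (exists P, is_prime_ideal P /\ f P = n).
    exists (c P); split=> [|Q Qp fQ]; first by case: (cP P).
    by congr c; apply: finj; rewrite ?inE ?fP ?fQ.
  exists 1; split=> [|P Pp fP]; first exact: regular1.
  by case: nP; exists P.
pose s j := \prod_(k < j.+1) t k.
exists s; split=> [j|r rr j].
  by rewrite /s; elim/big_rec: _ => [|k x _]; [exact: regular1 | apply: regularM; case: (tP k)].
have [l [lP lr]] := prime_product (img (scale_by (r : R^o))) noeth.
have [P Pl|q qE] := lr c.
  have [Pp rP] := lP _ Pl; case: (cP P) => _; apply; exists r => //.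
  by apply: rP; exists 1; rewrite linE scale1r.
suff [k [q' kq]] : exists k q', sprod s j k = q' * \prod_(P <- l) c P.
  exists k, (q' * q); rewrite kq -mulrA; congr (_ * _).
  by rewrite -qE linE.
elim: l lP {lr q qE} => [|P l IH] lP; first by exists 0%N, 1; rewrite sprod0 big_nil mul1r.
have [|k [q kq]] := IH; first by move=> Q Ql; apply: lP; rewrite inE Ql orbT.
have [Pp _] := lP P (mem_head _ _).
have ts m : (f P <= m)%N -> exists q', s m = q' * c P.
  move=> fm; rewrite /s (bigD1 (Ordinal (fm : (f P < m.+1)%N))) //=.
  have [_ tc] := tP (f P); rewrite (tc P Pp erefl) mulrC.
  by eexists.
have [q' q'E] := ts (j + (k + f P))%N (leq_trans (leq_addl _ _) (leq_addl _ _)).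
exists (k + f P).+1, (q * sprod s (j + k) (f P) * q').
by rewrite sprodSr q'E sprodD kq big_cons; ring.
Qed.

Lemma subr_exchange (V : zmodType) (a b c d : V) : a - b = c - d -> a - c = b - d.
Proof.
move=> /eqP; rewrite subr_eq => /eqP ->.
by rewrite addrAC [c - d - c]addrAC subrr add0r addrC.
Qed.

Section LimitSurjective.
Variable R : comNzRingType.

(** By induction on [n], over all towers: an element of [I 0] is lifted step by
    step, and a tower without its bottom stage has the same limit. *)
Lemma limit_proj_surjective (n : nat) (I : nat -> lmodType R)
    (p : forall n, {linear I n.+1 -> I n}) (L : lmodType R) (pi : forall n, {linear L -> I n}) :
  (forall n, surjective (p n)) -> is_inverse_limit p pi -> surjective (pi n).
Proof.
elim: n I p pi => [|n IH] I p pi pS lim.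
  move=> a; case: lim => piC ex.
  pose lift_step m (y : I m) : I m.+1 := sval (cid (pS m y)).
  have [|y [yE _]] := ex (nat_rect (fun m => I m) a lift_step).
    by move=> m /=; rewrite /lift_step; case: cid.
  by exists y; rewrite yE.
apply: (IH (fun m => I m.+1) (fun m => p m.+1) (fun m => pi m.+1)) => //.
case: lim => piC ex; split=> [m y|x xC]; first exact: piC.
pose x' m : I m := match m with 0 => p 0%N (x 0%N) | m.+1 => x m end.
have [|y [yE yU]] := ex x'; first by case.
exists y; split=> [m|z zE]; first exact: (yE m.+1).
by apply: yU => -[|m]; [rewrite -piC zE | exact: zE].
Qed.

End LimitSurjective.

Section LocalizedLimit.
Variables (R : comNzRingType) (s : nat -> R).
Hypothesis sr : forall j, regular (s j).
Variables (I : nat -> lmodType R) (p : forall n, {linear I n.+1 -> I n}).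
Variables (L : lmodType R) (pi : forall n, {linear L -> I n}).
Hypothesis Iinj : forall n, injective_module (I n).
Hypothesis pS : forall n, surjective (p n).
Hypothesis lim : is_inverse_limit p pi.

Let piC n y : p n (pi n.+1 y) = pi n y.
Proof. by case: lim. Qed.

Lemma pi_eq0 n m y : (n <= m)%N -> pi m y = 0 -> pi n y = 0.
Proof.
move=> /subnKC <-; elim: (m - n)%N => [|k IH]; first by rewrite addn0.
by rewrite addnS => y0; apply: IH; rewrite -piC y0 linear0.
Qed.

(** [Ext^1(Q, L) = 0] for [Q = R[1/s_0, 1/s_1, ...]].  As each [I j] is
    divisible, [z_j] can be moved into the kernel of [pi j] without changing the
    class of [z]; then the series [sum_k s_j ... s_(j+k-1) z_(j+k)] converges. *)
Lemma localization_ext_limit (z : nat -> L) : exists w, forall j, s j *: w j.+1 - w j = z j.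
Proof.
have /choice[next nextP] (ju : nat * L) : exists v, pi ju.1 (s ju.1 *: v) = pi ju.1 (z ju.1 + ju.2).
  have [a aE] := injective_divisible (@Iinj ju.1) (pi ju.1 (z ju.1 + ju.2)) (@sr ju.1).
  have [v vE] := limit_proj_surjective (n := ju.1) pS lim a.
  by exists v; rewrite linearZ /= vE aE.
pose u := nat_rect (fun=> L) 0 (fun j y => next (j, y)).
pose z' j := z j - s j *: u j.+1 + u j.
have z'0 j n : (n <= j)%N -> pi n (z' j) = 0.
  move=> nj; apply: (pi_eq0 nj); have /= e := nextP (j, u j).
  by rewrite /z' addrAC linearB /= -e subrr.
(* The series stops at [n], since [pi n] kills the later terms. *)
pose W j n : I n := - \sum_(k < n) sprod s j k *: pi n (z' (j + k)%N).
have WC j n : p n (W j n.+1) = W j n.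
  rewrite /W linearN linear_sum big_ord_recr /= linearZ /= piC z'0 ?leq_addl //.
  rewrite scaler0 addr0; congr (- _); apply: eq_bigr => k _.
  by rewrite linearZ /= piC.
have /choice[w' w'E] j : exists y, forall n, pi n y = W j n.
  case: lim => _ ex; have [y [yE _]] := ex (W j) (WC j); by exists y.
have w'P j : s j *: w' j.+1 - w' j = z' j.
  apply: (limit_eq lim) => n; rewrite linearB linearZ /= !w'E /W opprK scalerN.
  have -> : \sum_(k < n) sprod s j k *: pi n (z' (j + k)%N) =
      \sum_(k < n.+1) sprod s j k *: pi n (z' (j + k)%N).
    by rewrite big_ord_recr /= z'0 ?leq_addl // scaler0 addr0.
  rewrite big_ord_recl /= sprod0 scale1r addn0 scaler_sumr addrC -addrA.
  rewrite (_ : \sum_(k < n) _ = \sum_(k < n) s j *: (sprod s j.+1 k *: pi n (z' (j.+1 + k)%N))).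
    by rewrite subrr addr0.
  by apply: eq_bigr => k _; rewrite scalerA -sprodS /bump /= add1n addSnnS.
exists (fun j => w' j + u j) => j.
rewrite scalerDr opprD addrACA w'P /z'.
by rewrite -addrA [u j + _]addrCA subrr addr0 subrK.
Qed.

Hypothesis sE : exhausting s.
Hypothesis noeth : noetherian R.
Hypothesis her : hereditary R.

Let J n : lmodType R := dseq s (I n).
Let P : lmodType R := dprod J.

Let delta_fun (x : P) : P := fun n => x n - dmap s (p n) (x n.+1).

Fact delta_linear : linear delta_fun.
Proof.
move=> a x y; apply: dprodP => n.
rewrite -[LHS]/((a *: x n + y n) - dmap s (p n) (a *: x n.+1 + y n.+1)).
rewrite (linearP (dmap s (p n))) opprD addrACA -[_ - a *: _]scalerBr.
by [].
Qed.
Definition delta : {linear P -> P} := lin delta_linear.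

Lemma deltaE x n j : dval (delta x n) j = dval (x n) j - p n (dval (x n.+1) j).
Proof. by []. Qed.

(** [delta] is the map whose cokernel is the first derived limit of the groups
    [Hom(R[1/s_0, 1/s_1, ...], I n)].  Solving in each position [j] separately
    leaves an error in the limit [L], which [localization_ext_limit] removes. *)
Lemma delta_surjective : surjective delta.
Proof.
move=> x; have /choice[y' y'E] j : exists y : forall n, I n,
    forall n, dval (x n) j = y n - p n (y n.+1).
  exact: (lim1_surjective pS (fun n => dval (x n) j)).
pose z j n : I n := s j *: y' j.+1 n - y' j n.
have zC j n : p n (z j n.+1) = z j n.
  have := dvalS (x n) j; rewrite !y'E /z scalerBr (linearB (p n)) [p n (_ *: _)]linearZ /=.
  by move/subr_exchange.
have /choice[zl zlE] j : exists y, forall n, pi n y = z j n.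
  case: lim => _ ex; have [y [yE _]] := ex (z j) (zC j); by exists y.
have [w wE] := localization_ext_limit zl.
have ys n j : s j *: (y' j.+1 n - pi n (w j.+1)) = y' j n - pi n (w j).
  have := congr1 (pi n) (wE j); rewrite zlE /z scalerBr (linearB (pi n)) [pi n (_ *: _)]linearZ /= => /esym.
  exact: subr_exchange.
exists (fun n => to_dseq (ys n)); apply: dprodP => n; apply: dseqP => j.
rewrite deltaE !to_dseqE linearB /= piC y'E.
by rewrite opprB addrA subrK.
Qed.

(** The kernel of [delta] is the module of sequences in [L], on which the
    regular elements are invertible; so it is injective, and [delta] splits. *)
Lemma delta_split : exists sigma : {linear P -> P}, forall x, delta (sigma x) = x.
Proof.
have iL : linear (fun y : dseq s L => (fun n => dmap s (pi n) y) : P).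
  by move=> a u v; apply: dprodP => n; rewrite dprodD dprodZ linearP.
have Linj : injective_module (dseq s L).
  by apply: invertible_injective => //; [exact: dseq_torsion_free | exact: dseq_divisible].
have iI : injective (lin iL).
  apply: lin0P => y y0; apply: dseqP => j; apply: (limit_eq lim) => n.
  have /(congr1 (fun f : P => dval (f n) j)) := y0.
  by rewrite linE dmapE => ->; rewrite linear0.
have [ret retE] := Linj _ _ (lin iL) idfun iI.
have [x x0|sg sgE] := descend (q := delta) (f := idfun \- (lin iL \o ret)) delta_surjective.
  suff [y <-] : exists y, lin iL y = x.
    by rewrite /=; have /= -> := retE y; rewrite subrr.
  have xC n j : p n (dval (x n.+1) j) = dval (x n) j.
    have := deltaE x n j; rewrite x0 => /esym/eqP.
    by rewrite subr_eq0 => /eqP.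
  have /choice[y yE] j : exists y, forall n, pi n y = dval (x n) j.
    case: lim => _ ex; have [y [yE _]] := ex (fun n => dval (x n) j) (fun n => xC n j).
    by exists y.
  have ys j : s j *: y j.+1 = y j.
    by apply: (limit_eq lim) => n; rewrite linearZ /= !yE dvalS.
  exists (to_dseq ys); apply: dprodP => n; apply: dseqP => j.
  by rewrite linE dmapE to_dseqE yE.
exists sg => x; have [y <-] := delta_surjective x; rewrite sgE /= linearB /=.
suff -> : delta (lin iL (ret y)) = 0 by rewrite subr0.
apply: dprodP => n; apply: dseqP => j.
by rewrite deltaE !linE !dmapE piC subrr.
Qed.

(** A map from [F] to [I n] is a map from [F] to the module of sequences in
    [I n], by division; composition with the splitting of [delta] solves the
    equation there, and position 0 gives the result. *)
Lemma lim1_hom_divisible (F : lmodType R) (h : forall n, {linear F -> I n}) :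
  torsion_free F -> divisible F ->
  exists k : forall n, {linear F -> I n}, forall n y, h n y = k n y - p n (k n.+1 y).
Proof.
move=> tf dv.
have spr j : regular (sprod s 0 j).
  elim: j => [|j IH]; first by rewrite sprod0; exact: regular1.
  by rewrite sprodSr; apply: regularM.
have /choice[u uE] (yj : F * nat) : exists v, sprod s 0 yj.2 *: v = yj.1 by exact: dv.
have us y j : s j *: u (y, j.+1) = u (y, j).
  apply/subr0_eq/(tf _ _ (spr j)); rewrite scalerBr scalerA.
  have /= e := uE (y, j.+1); have /= e' := uE (y, j).
  by rewrite e' -[X in _ - X]e sprodSr subrr.
have uL j : linear (fun y => u (y, j)).
  move=> a x y; apply/subr0_eq/(tf _ _ (spr j)); rewrite scalerBr scalerDr scalerA mulrC -scalerA.
  have /= -> := uE (a *: x + y, j); have /= -> := uE (x, j); have /= -> := uE (y, j).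
  by rewrite subrr.
have hs n y j : s j *: h n (u (y, j.+1)) = h n (u (y, j)) by rewrite -linearZ us.
have HL : linear (fun y => (fun n => to_dseq (hs n y)) : P).
  move=> a x y; apply: dprodP => n; apply: dseqP => j.
  rewrite to_dseqE uL linearP; exact: erefl.
have [sg sgE] := delta_split.
have kL n : linear (fun y => dval (sg (lin HL y) n) 0).
  by move=> a x y; rewrite linearP /= linearP.
exists (fun n => lin (kL n)) => n y; rewrite !linE.
have := congr1 (fun f : P => dval (f n) 0) (sgE (lin HL y)).
rewrite deltaE linE to_dseqE => ->.
by have /= := uE (y, 0%N); rewrite sprod0 scale1r => ->.
Qed.

End LocalizedLimit.

Section LimitsCotorsion.
Variable R : comNzRingType.

(** [Q] is an injective module containing [F], modulo its torsion. *)
Lemma torsion_free_hull (F : lmodType R) : torsion_free F ->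
  exists (Q : lmodType R) (i : {linear F -> Q}),
    [/\ torsion_free Q, divisible Q & injective i].
Proof.
move=> tf; have [E [j [Einj jI]]] := enough_injectives F.
have T0 : exists2 s, regular s & s *: (0 : E) = 0.
  by exists 1; [exact: regular1 | rewrite scaler0].
have TL a (x y : E) : (exists2 s, regular s & s *: x = 0) ->
    (exists2 s, regular s & s *: y = 0) -> exists2 s, regular s & s *: (a *: x + y) = 0.
  move=> [s rs sx] [t rt ty]; exists (s * t); first exact: regularM.
  rewrite scalerDr -[(s * t) *: y]scalerA ty scaler0 addr0.
  have -> : (s * t) *: (a *: x) = (t * a) *: (s *: x).
    by rewrite !scalerA; congr (_ *: _); ring.
  by rewrite sx scaler0.
pose N := Submod T0 TL; exists (quot N), (proj N \o j); split.
- move=> s x rs; have [e <-] := @proj_surj _ _ N x.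
  rewrite -linearZ /= => /proj_eq0[t rt te]; apply/proj_eq0.
  by exists (t * s); [exact: regularM | rewrite -scalerA].
- move=> s x rs; have [e <-] := @proj_surj _ _ N x.
  have [e' e'E] := injective_divisible Einj e rs.
  by exists (proj N e'); rewrite -linearZ /= e'E.
- apply: lin0P => x /proj_eq0[t rt]; rewrite -linearZ /= => /(inj_eq0 jI).
  exact: tf.
Qed.

(** The obstruction to extending a map to [L] lies in the first derived limit of
    the [Hom(F, I n)]; embedding [F] in its torsion-free divisible hull [Q]
    makes it vanish. *)
Lemma in_L_cotorsion (L : lmodType R) : noetherian R -> hereditary R ->
  countable (Spec R) -> in_L L -> cotorsion L.
Proof.
move=> noeth her cS [I [p [pi [Iinj pS lim]]]] F flat P f fd.
have [s [sr sE]] := exhausting_sequence noeth cS.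
have [Q [i [Qtf Qdv iI]]] := torsion_free_hull (flat_torsion_free flat).
have [|b|a /pr_exactS[x <-]|h|g gE] := limit_extend (d := pr_diff P 0) (q := i \o pr_aug P)
  (f := f) lim Iinj.
- move=> a /=; have -> : pr_aug P (pr_diff P 0 a) = 0 by apply/pr_exact0; exists a.
  by rewrite linear0.
- by move=> /(inj_eq0 iI) /pr_exact0.
- exact: fd.
- exact: (lim1_hom_divisible sr Iinj pS lim sE noeth her h Qtf Qdv).
- by exists g => x; rewrite gE.
Qed.

Lemma cotorsion_summand (L M N : lmodType R) (iso : {linear (M * N)%type -> L}) :
  bijective iso -> cotorsion L -> cotorsion M.
Proof.
move=> [iso' isoK isoK'] Lc F flat P f fd.
have inL : linear (fun m : M => iso (m, 0)).
  by move=> a u v; rewrite -linearP; congr (iso (_, _)); rewrite /= scaler0 addr0.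
have [|g gE] := Lc F flat P (lin inL \o f); first by move=> x; rewrite /= fd linear0.
have [b|g' g'E] := factor_inj (f := g) (can_inj isoK).
  by exists (iso' (g b)); rewrite isoK'.
have g1L : linear (fun b => (g' b).1) by move=> a u v; rewrite linearP.
exists (lin g1L) => a; rewrite linE.
suff -> : g' (pr_diff P 0 a) = (f a, 0) by [].
by apply: (can_inj isoK); rewrite g'E -gE.
Qed.

Lemma in_C_cotorsion (M : lmodType R) : noetherian R -> hereditary R ->
  countable (Spec R) -> in_C M -> cotorsion M.
Proof.
move=> noeth her cS [L [N [/(in_L_cotorsion noeth her cS) Lc [iso bij]]]].
exact: cotorsion_summand bij Lc.
Qed.

Lemma in_L_summand (M D : lmodType R) : in_L (D * M)%type -> in_C M.
Proof.
move=> DM; exists (D * M)%type, D; split=> //.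
have swapL : linear (fun x : M * D => (x.2, x.1)) by [].
by exists (lin swapL), (fun x => (x.2, x.1)) => -[].
Qed.

End LimitsCotorsion.

(** * An uncountable spectrum *)

Section UncountableSpectrum.
Variable R : comNzRingType.
Hypothesis noeth : noetherian R.
Hypothesis her : hereditary R.

Definition has_regular (I : R -> Prop) := exists2 s, I s & regular s.

Definition strictly_contains (Q P : set R) :=
  is_prime_ideal P /\ (forall x, Q x -> P x) /\ exists2 x, P x & ~ Q x.

Lemma prime_prod (P : set R) (Pp : is_prime_ideal P) (T : eqType) (l : seq T) (c : T -> R) :
  P (\prod_(t <- l) c t) -> exists2 t, t \in l & P (c t).
Proof.
elim: l => [|t l IH]; first by rewrite big_nil => /(prime1 Pp).
rewrite big_cons => /(primeM Pp)[Pt|/IH[u ul Pu]]; first by exists t; rewrite // mem_head.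
by exists u; rewrite // inE ul orbT.
Qed.

(** The idempotent [e] killing [P] satisfies [e (1 - e) = 0], and [1 - e] in [Q]
    would give [P = (1 - e) P] inside [Q]. *)
Lemma strict_prime_regular (Q P : set R) : is_prime_ideal Q -> strictly_contains Q P ->
  has_regular P.
Proof.
move=> Qp [Pp [QP [y Py nQy]]].
have [x [e [Px ee eP rxe]]] := regular_complement (prime_submod Pp) noeth her.
have [Qe|Qe] : Q e \/ Q (1 - e).
  by apply: (primeM Qp); rewrite mulrBr mulr1 ee subrr; exact: prime0.
  have e0 : e = 0 by rewrite -ee; apply: eP; exact: QP.
  by exists x => //; rewrite -[x]addr0 -e0.
case: nQy; have -> : y = (1 - e) * y by rewrite mulrBl mul1r eP // subr0.
exact: primeMr.
Qed.

(** Let [x] be outside [P] and [J = P + (x)].  The coordinates on [J] of elements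
    of [P] are in [P], so [P = P J]; as [P] is invertible, [J = R]. *)
Lemma regular_prime_comaximal (P : set R) (x : R) : is_prime_ideal P -> has_regular P ->
  ~ P x -> exists (p r : R), P p /\ 1 = p + r * x.
Proof.
move=> Pp [s Ps rs] nPx.
have [n [a [psi [Pa psiL aP]]]] := her (prime_submod Pp).
have tr1 := trace_regular psiL Pa aP Ps rs.
pose J := add_principal (prime_submod Pp) x.
have [m [b [ph [Jb phL bJ]]]] := her J.
have PJ y : P y -> J y by exact: (add_principal_l (I := prime_submod Pp)).
have Jx : J x by exact: add_principal_r.
have phP k y : P y -> P (ph k y).
  move=> Py; have : P (x * ph k y).
    by rewrite (coordC phL k (PJ _ Py) Jx); exact: primeMr.
  by case/(primeM Pp).
suff [r [p [Pp' e]]] : J 1 by exists p, r.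
rewrite -tr1; apply: (submod_sum (N := J)) => j _.
rewrite {1}[a j]bJ; last exact: PJ (Pa j).
rewrite (coord_sum psiL); last by move=> k; apply: (primeMr Pp); exact: phP (Pa j).
apply: (submod_sum (N := J)) => k _; rewrite mulrC (coordZ psiL); last exact: phP (Pa j).
by rewrite mulrC; exact: (submodZ (N := J)).
Qed.

Section Square.
Variables (P : set R) (Pp : is_prime_ideal P).

Definition square (z : R^o) : Prop :=
  exists n (a b : 'I_n -> R), (forall i, P (a i) /\ P (b i)) /\ z = \sum_(i < n) a i * b i.

Fact square0 : square 0.
Proof. by exists 0%N, (fun=> 0), (fun=> 0); split=> [[]//|]; rewrite big_ord0. Qed.
Fact squareL c u v : square u -> square v -> square (c *: u + v).
Proof.
move=> [m [a [b [abP ->]]]] [n [a' [b' [abP' ->]]]].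
exists (m + n)%N, (fun i => match fintype.split i with inl i => c * a i | inr i => a' i end),
  (fun i => match fintype.split i with inl i => b i | inr i => b' i end).
split=> [i|]; first case: (fintype.split i) => j.
- by have [Pa Pb] := abP j; split=> //; exact: primeMl.
- exact: abP'.
rewrite big_split_ord /= scaler_sumr; congr (_ + _); apply: eq_bigr => i _.
  by rewrite -[lshift _ _]/(unsplit (inl i)) unsplitK -mulrA.
by rewrite -[rshift _ _]/(unsplit (inr i)) unsplitK.
Qed.
Definition square_submod : submod R^o := Submod square0 squareL.

Lemma square_mul x y : P x -> P y -> square (x * y).
Proof.
move=> Px Py; exists 1%N, (fun=> x), (fun=> y); split=> //.
by rewrite big_ord1.
Qed.

Lemma square_sub z : square z -> P z.
Proof.
move=> [n [a [b [abP ->]]]]; apply: (submod_sum (N := prime_submod Pp)) => i _.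
by have [Pa _] := abP i; exact: primeMr.
Qed.

(** If [P] were its own square, the coordinates of elements of [P] on [P] would
    all be in [P], and so would their trace 1. *)
Lemma square_proper : has_regular P -> exists2 x, P x & ~ square x.
Proof.
move=> [s Ps rs]; apply: contrapT => nx.
have sq x : P x -> square x.
  by move=> Px; apply: contrapT => nsx; apply: nx; exists x.
have [n [a [psi [Pa psiL aP]]]] := her (prime_submod Pp).
apply: (prime1 Pp); rewrite -(trace_regular psiL Pa aP Ps rs).
apply: (submod_sum (N := prime_submod Pp)) => j _.
have [m [u [v [uvP ->]]]] := sq _ (Pa j).
rewrite (coord_sum psiL); last by move=> i; have [Pu _] := uvP i; exact: primeMr.
apply: (submod_sum (N := prime_submod Pp)) => i _.
have [Pu Pv] := uvP i; rewrite (coordZ psiL) //; exact: primeMr.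
Qed.

Lemma square_regular : has_regular P -> has_regular square.
Proof.
by move=> [s Ps rs]; exists (s * s); [exact: square_mul | exact: regularM].
Qed.

End Square.

(** A prime that is not maximal is generated by an idempotent, so it equals its
    own square. *)
Lemma strict_prime_square (Q P : set R) q : is_prime_ideal Q -> strictly_contains Q P ->
  Q q -> square P q.
Proof.
move=> Qp [Pp [QP [y Py nQy]]] Qq.
have [x [e [Qx ee eQ rxe]]] := regular_complement (prime_submod Qp) noeth her.
have [Qe|Qe] : Q e \/ Q (1 - e).
  by apply: (primeM Qp); rewrite mulrBr mulr1 ee subrr; exact: prime0.
  have e0 : e = 0 by rewrite -ee; exact: eQ.
  have regQ : has_regular Q by exists x => //; rewrite -[x]addr0 -e0.
  have [p [r [Qp' one]]] := regular_prime_comaximal Qp regQ nQy.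
  case: (prime1 Pp); rewrite one; apply: primeD => //; first exact: QP.
  exact: primeMl.
have -> : q = (1 - e) * q by rewrite mulrBl mul1r eQ // subr0.
by apply: square_mul; exact: QP.
Qed.

Lemma strict_prime_maximal (Q P P' : set R) : is_prime_ideal Q -> strictly_contains Q P ->
  is_prime_ideal P' -> (forall x, P x -> P' x) -> P = P'.
Proof.
move=> Qp QP Pp' PP'; have Preg := strict_prime_regular Qp QP.
apply/seteqP; split=> [x|x P'x]; first exact: PP'.
apply: contrapT => nPx.
have [p [r [Pp one]]] := regular_prime_comaximal (proj1 QP) Preg nPx.
apply: (prime1 Pp'); rewrite one; apply: primeD => //; first exact: PP'.
exact: primeMl.
Qed.

Lemma prime_over (I : submod R^o) : exists l : seq (set R),
  (forall P, P \in l -> is_prime_ideal P /\ forall x, I x -> P x) /\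
  forall P, is_prime_ideal P -> (forall x, I x -> P x) ->
    exists2 P', P' \in l & forall x, P' x -> P x.
Proof.
have [l [lP lI]] := prime_product I noeth; exists l; split=> // P Pp IP.
apply: contrapT => nP.
have /choice[c cP] (P' : set R) : exists x, P' \in l -> P' x /\ ~ P x.
  have [P'l|P'l] := boolP (P' \in l); last by exists 0.
  apply: contrapT => nx; apply: nP; exists P' => // x P'x.
  by apply: contrapT => nPx; apply: nx; exists x.
have [|P' P'l Pc] := prime_prod Pp (l := l) (c := c).
  by apply: IP; apply: lI => P' /cP[].
by have [] := cP _ P'l.
Qed.

(** These primes contain the ideal [Q + (r)], hence one of the finitely many
    primes of [prime_over] for that ideal, which is maximal. *)
Lemma few_primes_contain (Q : set R) r : is_prime_ideal Q -> ~ Q r ->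
  countable [set P | strictly_contains Q P /\ P r].
Proof.
move=> Qp nQr; have [l [lP lI]] := prime_over (add_principal (prime_submod Qp) r).
apply: (@sub_countable _ _ _ [set` l]); last exact: finite_set_countable.
apply: subset_card_le => P [[Pp [QP [y Py nQy]]] Pr].
have [|P' P'l P'P] := lI P Pp.
  by move=> x [s [z [Qz ->]]]; apply: primeD => //; [exact: QP | exact: primeMl].
suff -> : P = P' by [].
have [Pp' JP'] := lP _ P'l.
apply/esym/(strict_prime_maximal Qp) => //; split=> //; split.
  by move=> x Qx; apply: JP'; exact: (add_principal_l (I := prime_submod Qp)).
by exists r => //; apply: JP'; exact: add_principal_r.
Qed.

(** Every prime contains one of the finitely many primes of [prime_over] for the
    zero ideal. *)
Lemma uncountable_above_prime : ~ countable (Spec R) ->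
  exists2 Q, is_prime_ideal Q & ~ countable [set P | strictly_contains Q P].
Proof.
move=> nc; apply: contrapT => nQ.
have cQ Q : is_prime_ideal Q -> countable [set P | strictly_contains Q P].
  by move=> Qp; apply: contrapT => ncQ; apply: nQ; exists Q.
have Z0 : (0 : R^o) = 0 by [].
have [l [lP lI]] := prime_over (Submod Z0 (@zero_L R)).
apply: nc.
pose C (Q : set R) :=
  \bigcup_(b in [set: bool]) if b then [set Q] else [set P | strictly_contains Q P].
apply: (@sub_countable _ _ _ (\bigcup_(Q in [set` l]) C Q)); last first.
  apply: bigcup_countable; first exact: finite_set_countable.
  move=> Q Ql; have [Qp _] := lP _ Ql.
  by apply: bigcup_countable => // -[] _; [exact: countable1 | exact: cQ].
apply: subset_card_le => P Pp.
have [|Q Ql QP] := lI P Pp; first by move=> x ->; exact: prime0.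
exists Q => //; have [[x Px nQx]|PQ] := pselect (exists2 x, P x & ~ Q x).
  by exists false => //; split=> //; split=> //; exists x.
exists true => //; apply/seteqP; split=> [x Px|//]; apply: contrapT => nQx; apply: PQ.
by exists x.
Qed.

End UncountableSpectrum.

(** * A limit of injectives that is not cotorsion *)

Section Noncotorsion.
Variable R : comNzRingType.
Hypothesis noeth : noetherian R.
Hypothesis her : hereditary R.

Fact fin0 : exists n, forall i, (n <= i)%N -> (0 : nat -> R^o) i = 0.
Proof. by exists 0%N. Qed.
Fact finL a (u v : nat -> R^o) : (exists n, forall i, (n <= i)%N -> u i = 0) ->
  (exists n, forall i, (n <= i)%N -> v i = 0) ->
  exists n, forall i, (n <= i)%N -> (a *: u + v) i = 0.
Proof.
move=> [m um] [n vn]; exists (maxn m n) => i; rewrite geq_max => /andP[mi ni].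
by rewrite -[LHS]/(a *: u i + v i) um // vn // scaler0 addr0.
Qed.
Definition finite_sequences : submod (nat -> R^o) := Submod fin0 finL.

(** As the quotient of a complete module by a dense submodule, this is a summand
    of a limit of injectives over every hereditary ring; whether it is cotorsion
    depends on the size of the spectrum. *)
Definition tails_module : lmodType R := quot finite_sequences.
Definition germ : {linear (nat -> R^o) -> tails_module} := proj finite_sequences.

Variable Q : set R.
Hypothesis Qp : is_prime_ideal Q.

Let above := strictly_contains Q.

(** [W] plays the part of the total ring of fractions, with unit [o]. *)
Variables (W : lmodType R) (o : W).
Hypothesis Wtf : torsion_free W.
Hypothesis Wdv : divisible W.
Hypothesis oI : forall r : R, r *: o = 0 -> r = 0.

Definition integral : submod W := img (scale_by o).

(** For [P] above [Q] this is the fractional ideal [P^(-2)]. *)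
Definition polar (P : set R) (w : W) := forall z, square P z -> integral (z *: w).

Lemma polarL P a u v : polar P u -> polar P v -> polar P (a *: u + v).
Proof.
move=> pu pv z sz; rewrite scalerDr scalerA mulrC -scalerA.
by apply: submodL; [exact: pu | exact: pv].
Qed.

Lemma integral_polar P w : integral w -> polar P w.
Proof.
by move=> iw z _; exact: submodZ.
Qed.

(** [P^2] is invertible: the coordinates of a dual basis of [P^2] are the
    multiplications by elements [w_j] of [P^(-2)]. *)
Lemma polar_unit (P : set R) : above P ->
  exists n (y : 'I_n -> R) (w : 'I_n -> W),
    [/\ forall j, square P (y j), forall j, polar P (w j) & \sum_(j < n) y j *: w j = o].
Proof.
move=> aP; have [Pp _] := aP.
have [s s2 rs] := square_regular (strict_prime_regular noeth her Qp aP).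
have [n [y [psi [Jy psiL yJ]]]] := her (square_submod Pp).
have /choice[w wE] j : exists w, s *: w = psi j s *: o by exact: Wdv.
have zw z j : square P z -> z *: w j = psi j z *: o.
  move=> sz; apply/subr0_eq/(Wtf rs); rewrite scalerBr.
  have -> : s *: (z *: w j) = z *: (s *: w j) by rewrite !scalerA mulrC.
  by rewrite wE !scalerA (coordC psiL j s2 sz) subrr.
exists n, y, w; split=> // [j z sz|]; first by exists (psi j z); rewrite zw.
under eq_bigr => j _ do rewrite (zw _ _ (Jy j)).
by rewrite -scaler_suml (trace_regular psiL Jy yJ s2 rs) scale1r.
Qed.

(** Distinct primes above [Q] are comaximal, so partial fractions are unique up
    to integral elements. *)
Lemma polar_sum_integral (l : seq (set R)) (n : set R -> W) P0 :
  uniq l -> P0 \in l -> above P0 ->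
  (forall P, P \in l -> above P \/ n P = 0) -> (forall P, above P -> polar P (n P)) ->
  integral (\sum_(P <- l) n P) -> integral (n P0).
Proof.
move=> ul P0l a0 nl np int; have [Pp0 _] := a0.
have /choice[c cP] (P : set R) : exists z, (above P -> P <> P0 -> P z) /\ ~ P0 z.
  have [[aP PP0]|nP] := pselect (above P /\ P <> P0); last first.
    by exists 1; split; [move=> aP PP0; case: nP | exact: prime1].
  apply: contrapT => nz; apply: PP0; apply: (strict_prime_maximal noeth her Qp aP Pp0) => x Px.
  by apply: contrapT => nx; apply: nz; exists x.
pose v := \prod_(P <- l | P != P0) (c P * c P).
have nv : ~ P0 v.
  rewrite /v -big_filter => /(prime_prod Pp0)[P _] /(primeM Pp0)[]; by case: (cP P).
have vn P : P \in l -> P != P0 -> integral (v *: n P).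
  move=> Pl PP0; have [aP|->] := nl P Pl; last by rewrite scaler0; exact: submod0.
  have vE : v = \prod_(P' <- l | (P' != P0) && (P' != P)) (c P' * c P') * (c P * c P).
    rewrite /v -big_filter (bigD1_seq P) ?filter_uniq ?mem_filter ?PP0 //=.
    by rewrite mulrC big_filter_cond.
  rewrite vE -scalerA; apply: submodZ.
  by apply: (np P aP); apply: square_mul; case: (cP P) => + _; apply=> //; exact/eqP.
have vn0 : integral (v *: n P0).
  have -> : v *: n P0 = v *: (\sum_(P <- l) n P) - \sum_(P <- l | P != P0) v *: n P.
    by rewrite (bigD1_seq P0) //= scalerDr scaler_sumr addrK.
  apply: submodB; first exact: submodZ.
  rewrite big_seq_cond; apply: submod_sum => P /andP[Pl PP0].
  exact: vn.
(* From [1 = p + r v], squaring gives [1 = p^2 + r (1 + p) v]. *)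
have [p [r [P0p one]]] := regular_prime_comaximal her Pp0 (strict_prime_regular noeth her Qp a0) nv.
have -> : n P0 = (p * p) *: n P0 + (r * (1 + p)) *: (v *: n P0).
  rewrite scalerA -scalerDl -[LHS]scale1r; congr (_ *: _).
  have pE : p = 1 - r * v by rewrite one addrK.
  by rewrite pE; ring.
apply: submodD; first by apply: (np P0 a0); exact: square_mul.
exact: submodZ.
Qed.

Let X : choiceType := set R.

(** [fractions] is the direct sum of [R] and of the [P^(-2)] for [P] above [Q].
    The kernel of its sum map to [W] is free on these primes: it is the image of
    [relations] under [inclusion]. *)
Let frac_mem (b : (R^o * dsum X W)%type) :=
  (forall P, above P -> polar P (sv b.2 P)) /\ (forall P, ~ above P -> sv b.2 P = 0).

Fact frac0 : frac_mem 0.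
Proof.
by split=> [P _|//]; apply: integral_polar; exact: (submod0 integral).
Qed.
Fact fracL a u v : frac_mem u -> frac_mem v -> frac_mem (a *: u + v).
Proof.
move=> [up u0] [vp v0]; split=> P aP.
  by rewrite dsum_addE dsum_scaleE; apply: polarL; [exact: up | exact: vp].
by rewrite dsum_addE dsum_scaleE u0 // v0 // scaler0 addr0.
Qed.
Let fractions : lmodType R := subm (Submod frac0 fracL).
Let fraction b (bm : frac_mem b) : fractions := Subm (N := Submod frac0 fracL) bm.

Fact rel0 : forall P, ~ above P -> sv (0 : free R X) P = 0. Proof. by []. Qed.
Fact relL a (u v : free R X) : (forall P, ~ above P -> sv u P = 0) ->
  (forall P, ~ above P -> sv v P = 0) -> forall P, ~ above P -> sv (a *: u + v) P = 0.
Proof. by move=> u0 v0 P nP; rewrite dsum_addE dsum_scaleE u0 // v0 // scaler0 addr0. Qed.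
Let relations : lmodType R :=
  subm (Submod (smem := fun a : free R X => forall P, ~ above P -> sv a P = 0) rel0 relL).

Let relation (a : free R X) (am : forall P, ~ above P -> sv a P = 0) : relations :=
  Subm (N := Submod (smem := fun a : free R X => forall P, ~ above P -> sv a P = 0) rel0 relL) am.

Lemma spread_supp (a : free R X) : fin_supp (fun P => (sv a P : R) *: o).
Proof.
by exists (dsupp a) => P /dsuppP ->; rewrite scale0r.
Qed.
Let spread (a : free R X) : dsum X W :=
  Subm (N := Submod (fin_supp0 X W) (@fin_suppL R X W)) (spread_supp a).
Lemma spreadE a P : sv (spread a) P = (sv a P : R) *: o. Proof. by []. Qed.
Fact spread_linear : linear spread.
Proof.
move=> c u v; apply: dsumP => P; rewrite dsum_addE dsum_scaleE !spreadE.
by rewrite dsum_addE dsum_scaleE; exact: (scale_linear o c (sv u P) (sv v P)).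
Qed.
Let trace : {linear free R X -> R^o} := free_map (fun _ : X => 1 : R^o).

Fact inclusion_mem (a : relations) : frac_mem (- trace (sv a), spread (sv a)).
Proof.
split=> P aP /=; last by rewrite (svP a) // scale0r.
by apply: integral_polar; exists (sv (sv a) P).
Qed.
Fact inclusion_linear :
  linear (fun a : relations => fraction (inclusion_mem a)).
Proof.
move=> c u v; apply: sv_inj.
rewrite -[LHS]/(- trace (c *: sv u + sv v), spread (c *: sv u + sv v)).
rewrite spread_linear linearP opprD -scalerN; exact: erefl.
Qed.
Let inclusion : {linear relations -> fractions} := lin inclusion_linear.

Lemma inclusion_inj : injective inclusion.
Proof.
apply: lin0P => a /(congr1 (@sv _ _ _)) /(congr1 snd) /= e.
apply: sv_inj; apply: dsumP => P; apply: oI.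
by have /(congr1 (fun h => sv h P)) := e.
Qed.

Let sum_map : {linear dsum X W -> W} := dsum_map (fun _ : X => idfun : {linear W -> W}).

Fact total_linear : linear (fun b : fractions => ((sv b).1 : R) *: o + sum_map (sv b).2).
Proof.
move=> c u v; rewrite -[LHS]/((c * (sv u).1 + (sv v).1 : R) *: o +
  sum_map (c *: (sv u).2 + (sv v).2)).
by rewrite (linearP sum_map) scalerDl addrACA -scalerA -scalerDr.
Qed.
Let total : {linear fractions -> W} := lin total_linear.

Lemma total_inclusion a : total (inclusion a) = 0.
Proof.
rewrite linE /= scaleNr; apply/eqP; rewrite addrC subr_eq0; apply/eqP.
have uns : uniq (dsupp (sv a)) by exact: dsupp_uniq.
rewrite /sum_map (dsum_mapE _ uns); last by move=> P /dsuppP /= ->; rewrite scale0r.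
rewrite /trace /free_map (dsum_mapE _ uns); last exact: dsuppP.
rewrite scaler_suml; apply: eq_bigr => P _ /=.
by rewrite linE -[_ *: 1]/(_ * 1) mulr1.
Qed.

Lemma total_eq0 b : total b = 0 -> exists a, inclusion a = b.
Proof.
rewrite linE => tb; have [bp b0] := svP b.
set r := (sv b).1 in tb; set n := (sv b).2 in tb bp b0.
have un : uniq (dsupp n) by exact: dsupp_uniq.
have intn P : integral (sv n P).
  have [Pn|/dsuppP ->] := boolP (P \in dsupp n); last exact: submod0.
  have [aP|naP] := pselect (above P); last by rewrite b0 //; exact: submod0.
  apply: (@polar_sum_integral (dsupp n) (sv n)) => // [P' _|].
    by have [|/b0] := pselect (above P'); [left|right].
  have -> : \sum_(P' <- dsupp n) sv n P' = (- r) *: o.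
    have := tb; rewrite /sum_map (dsum_mapE _ un); last exact: dsuppP.
    by rewrite scaleNr => /eqP; rewrite addrC addr_eq0 => /eqP.
  by exists (- r).
have /choice[al alE] P : exists x : R, x *: o = sv n P by exact: intn.
have al0 P : sv n P = 0 -> al P = 0 by move=> n0; apply: oI; rewrite alE.
have fal : fin_supp (al : X -> R^o) by exists (dsupp n) => P /dsuppP /al0.
pose a : free R X := Subm (N := Submod (fin_supp0 X R^o) (@fin_suppL R X R^o)) fal.
have ra P : ~ above P -> sv a P = 0 by move=> nP; apply: al0; exact: b0.
pose a' := relation ra; exists a'.
have e2 : spread a = n by apply: dsumP => P; exact: alE.
have e1 : - trace a = r.
  have := total_inclusion a'; rewrite linE.
  have -> : (sv (inclusion a')).1 = - trace a by [].
  have -> : (sv (inclusion a')).2 = n by exact: e2.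
  rewrite -tb => /addIr /eqP; rewrite -subr_eq0 -scalerBl => /eqP /oI /eqP.
  by rewrite subr_eq0 => /eqP.
apply: sv_inj; have -> : sv (inclusion a') = (- trace a, spread a) by [].
rewrite e1 e2 /r /n; by case: (sv b).
Qed.

(** If [tails_module] were cotorsion, some sequence [rho] in [R] would satisfy
    [x_P + rho_i \in P^2] for almost all [i], for all [P] above [Q], with [x_P]
    in [P] but not in [P^2].  So some [rho_i] lies in uncountably many of the
    [P], hence in [Q], hence in all the [P^2], which puts [x_P] into [P^2]. *)
Lemma tails_module_cotorsion_countable : gldim_le R 1 -> cotorsion tails_module ->
  countable [set P | above P].
Proof.
move=> gl Mc; apply: contrapT => nc.
have /choice[x xE] (P : set R) : exists x, above P -> P x /\ ~ square P x.
  have [aP|nP] := pselect (above P); last by exists 0.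
  have [Pp _] := aP; have [x Px nx] := square_proper her Pp (strict_prime_regular noeth her Qp aP).
  by exists x.
pose fP (P : X) : tails_module := germ (fun _ => x P).
have [s b rs [a ab]|g gE] := cotorsion_extend (free_map fP \o incl _) noeth her gl Mc inclusion_inj.
  apply: total_eq0; apply: (Wtf rs); rewrite -linearZ /= -ab.
  exact: total_inclusion.
have one_mem : frac_mem (1, 0).
  by split=> [P _|//]; apply: integral_polar; exact: (submod0 integral).
pose b1 := fraction one_mem.
have [rho rhoE] := @proj_surj _ _ finite_sequences (g b1).
have close P : above P -> exists N, square P (x P + rho N).
  move=> aP.
  have single_mem w : polar P w -> frac_mem (0, single W (P : X) w).
    move=> pw; split=> P' aP' /=; last by case: eqP => // P'P; case: aP'; rewrite P'P.
    by case: eqP => [->//|_]; apply: integral_polar; exact: (submod0 integral).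
  have [n [y [w [sy pw yw]]]] := polar_unit aP.
  have po : polar P o by apply: integral_polar; exists 1; rewrite linE scale1r.
  pose bo := fraction (single_mem _ po).
  pose bw j := fraction (single_mem _ (pw j)).
  have boE : bo = \sum_(j < n) y j *: bw j.
    apply: sv_inj; have -> : sv (\sum_(j < n) y j *: bw j) = \sum_(j < n) y j *: sv (bw j).
      by elim/big_rec2: _ => // j u1 u2 _ <-.
    rewrite -[LHS]/(0, single W (P : X) o) -{1}yw.
    have -> : (0, single W (P : X) (\sum_(j < n) y j *: w j)) =
        \sum_(j < n) y j *: ((0, single W (P : X) (w j)) : (R^o * dsum X W)%type).
      rewrite linear_sum; elim/big_rec2: _ => [//|j u1 u2 _ <-].
      by rewrite linearZ; congr (_, _); rewrite /= scaler0 addr0.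
    by [].
  have ram : forall P', ~ above P' -> sv (fgen R (P : X)) P' = 0.
    by move=> P' nP' /=; case: eqP => // P'P; case: nP'; rewrite P'P.
  pose a := relation ram.
  have ia : inclusion a = bo - b1.
    apply: sv_inj; congr (_, _).
      by rewrite /= /trace free_map_gen sub0r.
    apply: dsumP => P'; rewrite dsum_addE /= oppr0 addr0.
    by case: eqP => _; rewrite ?scale1r ?scale0r.
  have : g bo = germ (fun _ => x P) + germ rho.
    have := gE a; rewrite ia linearB /= => /eqP; rewrite subr_eq => /eqP ->.
    by rewrite /= free_map_gen /fP -rhoE.
  have /choice[ga gaE] j : exists ga, germ ga = g (bw j).
    by have [ga e] := @proj_surj _ _ finite_sequences (g (bw j)); exists ga.
  rewrite boE linear_sum.
  have -> : \sum_(j < n) g (y j *: bw j) = germ (\sum_(j < n) y j *: ga j).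
    by rewrite linear_sum; apply: eq_bigr => j _; rewrite !linearZ /= -gaE.
  rewrite -linearD => /proj_eq[N NE]; exists N.
  have sumE : (\sum_(j < n) y j *: ga j) N = \sum_(j < n) y j * ga j N.
    by elim/big_rec2: _ => // j u1 u2 _ <-.
  have := NE N (leqnn N).
  rewrite -[LHS]/((\sum_(j < n) y j *: ga j) N - (x P + rho N)) sumE => /eqP.
  have [Pp _] := aP.
  rewrite subr_eq0 => /eqP <-; apply: (submod_sum (N := square_submod Pp)) => j _.
  by rewrite mulrC; apply: (submodZ (N := square_submod Pp)); exact: sy.
have [N nN] : exists N, ~ countable [set P | above P /\ square P (x P + rho N)].
  apply: contrapT => nN; apply: nc.
  apply: (@sub_countable _ _ _ (\bigcup_(N in [set: nat]) [set P | above P /\ square P (x P + rho N)])).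
    by apply: subset_card_le => P aP; have [N sN] := close P aP; exists N.
  apply: bigcup_countable => // N _; apply: contrapT => nN'; apply: nN.
  by exists N.
have Prho P : above P -> square P (x P + rho N) -> P (rho N).
  move=> aP sP; have [Pp _] := aP; have [Px _] := xE P aP.
  have -> : rho N = (x P + rho N) - x P by rewrite addrC addKr.
  by apply: primeB => //; exact: square_sub sP.
have Qrho : Q (rho N).
  apply: contrapT => nQ; apply: nN.
  apply: (@sub_countable _ _ _ _ _ (few_primes_contain noeth her Qp nQ)).
  by apply: subset_card_le => P [aP sP]; split=> //; exact: Prho.
apply: nN; suff -> : [set P | above P /\ square P (x P + rho N)] = set0 by exact: countable0.
apply/seteqP; split=> // P [aP sP].
have [Pp _] := aP; have [_] := xE P aP; apply.
have -> : x P = (x P + rho N) - rho N by rewrite addrK.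
apply: (submodB (N := square_submod Pp)) => //.
exact: (strict_prime_square noeth her Qp aP).
Qed.

End Noncotorsion.

(** * The equivalence *)

Lemma tails_module_in_C (R : comNzRingType) : quotients_injective R -> in_C (tails_module R).
Proof.
move=> qi; have [||D [_ DL]] := dense_quotient_in_L (phi := germ R) _ _ qi.
- exact: proj_surj.
- by move=> g n gn; apply/proj_eq0; exists n.
- exact: in_L_summand DL.
Qed.

Theorem theoremC (R : comNzRingType) (hR : noetherian R) :
  ((forall M : lmodType R, in_C M <-> cotorsion M) <->
     (gldim_le R 1 /\ countable (Spec R)))
  /\
  (gldim_le R 1 /\ countable (Spec R) ->
     forall C : lmodType R, cotorsion C ->
       exists D : lmodType R, injective_module D /\ in_L (D * C)%type).
Proof.
split; last by move=> [gl _] C; exact: cotorsion_in_L.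
split=> [CE|[gl cS] M].
  have her : hereditary R.
    by apply: cotorsion_in_C_hereditary => // M /CE.
  have qi := hereditary_quotients_injective her.
  have gl := quotients_injective_gldim1 qi.
  split=> //; apply: contrapT => /(uncountable_above_prime hR)[Q Qp]; apply.
  have tfR : torsion_free (R^o : lmodType R) by move=> s x rs; exact: rs.
  have [W [i [Wtf Wdv iI]]] := torsion_free_hull tfR.
  apply: (tails_module_cotorsion_countable hR her Qp Wtf Wdv (o := i 1)) => //.
    move=> r; rewrite -linearZ /= => /(inj_eq0 iI); rewrite -[_ *: _]/(r * 1).
    by rewrite mulr1.
  by apply/CE; exact: tails_module_in_C.
have her := quotients_injective_hereditary hR (gldim1_quotients_injective gl).
split; first exact: in_C_cotorsion.
by move=> /(cotorsion_in_L hR gl)[D [_ /in_L_summand]].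
Qed.
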